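(* (Truncated pendulum.) Let $H=\frac12y^2+\frac12x^2-\frac14x^4$ and let $M_n(h)$ be the first nonzero coefficient in the expansion $d(h,\varepsilon)=\sum_{k\ge1}M_k(h)\varepsilon^k$ of the displacement function at $H=h$, $h\in(0,\frac14)$, of the deformation $X_{\lambda(\varepsilon)}$. Put $$\begin{aligned}L_n(h)=&\Big[-\big(\tfrac43\lambda_{6,n}+\tfrac{320}{231}\lambda_{5,n}\big)h+\big(\tfrac{32}{21}\lambda_{6,n}+\tfrac{40}{231}\lambda_{5,n}+\tfrac87\lambda_{4,n}-\tfrac37\lambda_{3,n}+\lambda_{2,n}\big)\Big]I_2(h)\\&+\Big[\tfrac{240}{77}\lambda_{5,n}h^2-\big(\tfrac{16}{21}\lambda_{6,n}+\tfrac{20}{231}\lambda_{5,n}+\tfrac47\lambda_{4,n}-\tfrac{12}{7}\lambda_{3,n}\big)h+\lambda_{1,n}\Big]I_0(h).\end{aligned}$$ Then for any $n\in\mathbb{N}$: if $n=3m$ with $m\in\mathbb{N}$, $$M_n(h)=L_n(h)-\tfrac{8}{1001}\lambda_{3,m}^3\Big[(308h^2-181h+24)I_2(h)+(80h^2-12h)I_0(h)\Big],$$ and if $n$ is not a multiple of $3$, $M_n(h)=L_n(h)$.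
   Context: The perturbed system is $$X_\lambda:\quad \dot x=H_y,\qquad \dot y=-H_x+(\lambda_1+\lambda_2x^2+\lambda_3y^2+\lambda_4x^4+\lambda_5y^4+\lambda_6x^6)\,y,$$ considered along an analytic arc $\varepsilon\mapsto\lambda(\varepsilon)$ with $\lambda_j(\varepsilon)=\sum_{k=1}^\infty\lambda_{j,k}\varepsilon^k$, $1\le j\le6$ (so $\lambda_{j,k}$ denotes the coefficient of $\varepsilon^k$ in $\lambda_j$, and $\lambda_{3,m}$ that of $\varepsilon^m$ in $\lambda_3$). The ovals around the origin contained in $\{H=h\}$, $0<h<\frac14$, form the period annulus of $X_0$. The displacement function is $d(h,\varepsilon)=P(h,\varepsilon)-h$, where $P(\cdot,\varepsilon)$ is the first return map of $X_{\lambda(\varepsilon)}$ on a cross-section to the periodic orbits of the annulus, parametrized by the value $h$ of $H$; it is analytic in $h,\varepsilon$. $I_0(h)=\int_{H=h}y\,dx$ and $I_2(h)=\int_{H=h}x^2y\,dx$ are integrals over this oval oriented by the flow of $X_0$. *)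

(* Defs.v *)
From Stdlib Require Import Reals.
From Coquelicot Require Import Coquelicot.
Open Scope R_scope.

Definition H (x y : R) : R := y ^ 2 / 2 + x ^ 2 / 2 - x ^ 4 / 4.

(* Only the entries l 1, ..., l 6 of the parameter vector l are used. *)
Definition Xx (l : nat -> R) (x y : R) : R := Derive (fun v => H x v) y.
Definition Xy (l : nat -> R) (x y : R) : R :=
  - Derive (fun u => H u y) x
  + (l 1%nat + l 2%nat * x ^ 2 + l 3%nat * y ^ 2 + l 4%nat * x ^ 4
     + l 5%nat * y ^ 4 + l 6%nat * x ^ 6) * y.

Definition trajectory (l : nat -> R) (T : R) (x y : R -> R) : Prop :=
  forall t, 0 <= t <= T ->
    is_derive x t (Xx l (x t) (y t)) /\ is_derive y t (Xy l (x t) (y t)).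

(* For 0 < h < 1/4 the level set {H = h} is a compact oval around the origin
   together with two unbounded branches; no branch meets x = 1 or x = -1 and
   the oval is the part with -1 < x < 1. *)
Definition oval (h x y : R) : Prop := H x y = h /\ -1 < x < 1.

(* A parametrization by the flow of X_0 (hence oriented by it) of the oval at
   level h, run through exactly once: T is the minimal period. *)
Definition oval_param (h T : R) (x y : R -> R) : Prop :=
  0 < T /\ trajectory (fun _ => 0) T x y /\
  (forall t, 0 <= t <= T -> oval h (x t) (y t)) /\
  x T = x 0 /\ y T = y 0 /\
  (forall t, 0 < t < T -> ~ (x t = x 0 /\ y t = y 0)).

(* The line integral of f(x,y) dx along the curve (x,y) on [0,T]. *)
Definition line_integral_dx (f : R -> R -> R) (x y : R -> R) (T : R) : R :=
  RInt (fun t => f (x t) (y t) * Derive x t) 0 T.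

Definition analytic_at (f : R -> R) (h0 : R) : Prop :=
  exists a : nat -> R, locally h0 (fun h => is_pseries a (h - h0) (f h)).

(* An analytic curve meeting the oval at level h in the point (sx h, sy h).
   It is transversal to X_0: differentiating H (sx h) (sy h) = h shows that its
   velocity is not tangent to the level curves of H. *)
Definition cross_section (sx sy : R -> R) : Prop :=
  forall h, 0 < h < 1 / 4 ->
    oval h (sx h) (sy h) /\ analytic_at sx h /\ analytic_at sy h.

(* The trajectory of X_l starting at the point of the section with H = h meets
   the section again, for the first time, at the point with H = p. *)
Definition first_return (sx sy : R -> R) (l : nat -> R) (h p : R) : Prop :=
  exists (T : R) (x y : R -> R),
    0 < T /\ trajectory l T x y /\
    x 0 = sx h /\ y 0 = sy h /\
    0 < p < 1 / 4 /\ x T = sx p /\ y T = sy p /\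
    (forall t q, 0 < t < T -> 0 < q < 1 / 4 -> ~ (x t = sx q /\ y t = sy q)).

(* f(eps) = sum_{k >= 1} c_k eps^k for all eps near 0; c 0 is not used. *)
Definition expansion (c : nat -> R) (f : R -> R) : Prop :=
  locally 0 (fun eps : R => is_series (fun k => c (S k) * eps ^ S k) (f eps)).

(* c j k is the coefficient of eps^k in the j-th parameter; I0 and I2 are the
   values of the two integrals at h. *)
Definition L (c : nat -> nat -> R) (n : nat) (h I0 I2 : R) : R :=
  (- (4 / 3 * c 6%nat n + 320 / 231 * c 5%nat n) * h
   + (32 / 21 * c 6%nat n + 40 / 231 * c 5%nat n + 8 / 7 * c 4%nat n
      - 3 / 7 * c 3%nat n + c 2%nat n)) * I2
  + (240 / 77 * c 5%nat n * h ^ 2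
     - (16 / 21 * c 6%nat n + 20 / 231 * c 5%nat n + 4 / 7 * c 4%nat n
        - 12 / 7 * c 3%nat n) * h
     + c 1%nat n) * I0.

(* Main.v *)
Require Import Defs.
From Stdlib Require Import Reals Lra Lia List Ranalysis5.
From Coquelicot Require Import Coquelicot.
Open Scope R_scope.
Import ListNotations.

(** Write the second equation of the perturbed system as [y' = - x + x ^ 3 + f y], with [f]
    the polynomial [friction].  Along an orbit [H' = f y ^ 2], so the displacement is the
    integral of [f y ^ 2] over one turn.

    The difficulty is the direction [Q = y ^ 2 - 3 x ^ 2 + 3 x ^ 4] ([exact_friction]) in the
    space of friction polynomials: on the orbits of [X_0] one has [Q y ^ 2 = (x y ^ 3)'], hence
    [Q] contributes nothing at first order, and it contributes nothing at second order either
    because [x y ^ 3 Q] is again a derivative, of a polynomial [R] ([secondary]).  Splitting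
    [f = a Q + g] with [a = lambda_3], so that [g] has the coefficients [lambda_1],
    [lambda_2 + 3 lambda_3], [lambda_4 - 3 lambda_3], [lambda_5] and [lambda_6], one corrects
    the energy to [W = H - a x y ^ 3 + 3 a ^ 2 R].  Then, exactly and not merely up to higher order
    ([corrected_energy_along]),
      [W' = 3 a ^ 3 Q (dR/dy) y + g y (dW/dy)].
    If [g] vanishes to order [n - 1] in [eps] and [a ^ 3 = kappa eps ^ n + o(eps ^ n)], then
    dividing by [eps ^ n] and letting [eps] tend to 0 gives [M_n] as the integral over the
    oval, with respect to time, of [3 kappa Q (dR/dy) y + g_n y ^ 2] ([melnikov_limit]).
    No derivative of the flow with respect to [eps] occurs: uniform convergence of the perturbed
    orbit and of its return time to the unperturbed ones is enough ([return_close]).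

    The integral does not change when the derivative of a polynomial along [X_0] is added to
    the integrand.  In this way it becomes the formula to be proved
    ([melnikov_L_form]), and also an integral of [p (x ^ 2) y ^ 2] with [p] of degree 5, whose
    coefficients determine [kappa] and [g_n] ([melnikov_even_form]).  On small ovals the
    lowest term of [p] dominates, so [p = 0] as soon as all the integrals vanish
    ([even_polynomial_zero]).  By induction on [k < n], the vanishing of [M_k] thus gives
    [g_k = 0] and, for [k = 3 m], [lambda_(3,m) = 0].  At order [n] this leaves
    [kappa = lambda_(3,m) ^ 3] if [n = 3 m], and [kappa = 0] if 3 does not divide [n].

    For [eps = 0] the return map itself provides a closed orbit on each oval, and the two
    integrals over an oval do not depend on the parametrization ([oval_integral_unique]). *)

(** * Real analysis *)

Lemma small2 (a b : R) : 0 < a -> 0 < b -> exists r, 0 < r /\ r <= a /\ r <= b.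
Proof.
  intros Ha Hb; exists (Rmin a b).
  split; [apply Rmin_case; assumption | split; [apply Rmin_l | apply Rmin_r]].
Qed.

Lemma small3 (a b c : R) : 0 < a -> 0 < b -> 0 < c ->
  exists r, 0 < r /\ r <= a /\ r <= b /\ r <= c.
Proof.
  intros Ha Hb Hc; destruct (small2 a b Ha Hb) as (r & Hr & Hra & Hrb).
  destruct (small2 r c Hr Hc) as (s & Hs & Hsr & Hsc).
  exists s; repeat split; lra.
Qed.

Lemma small_list (l : list R) :
  List.Forall (fun a => 0 < a) l -> exists r, 0 < r /\ List.Forall (fun a => r <= a) l.
Proof.
  induction l as [| a l IH]; intros Hl; [exists 1; split; [lra | constructor] |].
  inversion Hl as [| ? ? Ha Hl']; subst.
  destruct (IH Hl') as (r & Hr & Hrl).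
  destruct (small2 a r Ha Hr) as (s & Hs & Hsa & Hsr); exists s; split; [exact Hs |].
  constructor; [exact Hsa |].
  revert Hrl; apply Forall_impl; intros b Hb; lra.
Qed.

Lemma small_scaled (l : list R) (C : R) : 0 < C ->
  List.Forall (fun a => 0 < a) l -> exists r, 0 < r /\ List.Forall (fun a => C * r <= a) l.
Proof.
  intros HC Hl; destruct (small_list l Hl) as (r & Hr & Hrl).
  exists (r / C); split; [apply Rdiv_lt_0_compat; lra |].
  replace (C * (r / C)) with r by (field; lra); exact Hrl.
Qed.

Ltac forall_inv := repeat match goal with
  | X : List.Forall _ (_ :: _) |- _ =>
      let A := fresh "Hsm" in
      let B := fresh in
      apply Forall_cons_iff in X; destruct X as [A B]; cbv beta in A
  | X : List.Forall _ nil |- _ => clear X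
  end.

Ltac rabs := repeat match goal with
  | X : Rabs _ <= _ |- _ => apply Rabs_le_between in X
  | X : Rabs _ < _ |- _ => apply Rabs_lt_between in X
  end.

Ltac to_R := match goal with |- @eq _ ?a ?b => change (@eq R a b) end.

Lemma continuous_eps (f : R -> R) (t e : R) :
  continuous f t -> 0 < e ->
  exists d, 0 < d /\ forall s, Rabs (s - t) < d -> Rabs (f s - f t) < e.
Proof.
  intros Hc He.
  destruct (proj1 (filterlim_locally f (f t)) Hc (mkposreal e He)) as [d Hd].
  exists d; split; [apply cond_pos |]; intros s Hs; exact (Hd s Hs).
Qed.

(** Bootstrapping: a bound for [E] that is only available while [E <= 1] can be used up to the
    time [m]. *)
Lemma first_exit (E : R -> R) (t1 : R) :
  0 <= t1 -> (forall t, 0 <= t <= t1 -> continuous E t) ->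
  E 0 < 1 -> 1 <= E t1 ->
  exists m, 0 <= m <= t1 /\ 1 <= E m /\ forall s, 0 <= s <= m -> E s <= 1.
Proof.
  intros Ht1 Hc H0 H1.
  set (S := fun s => 0 <= s <= t1 /\ forall r, 0 <= r <= s -> E r < 1).
  destruct (completeness S) as [m [Hub Hleast]].
  - exists t1; intros s [Hs _]; lra.
  - exists 0; split; [lra |]; intros r Hr; replace r with 0 by lra; exact H0.
  - assert (Hm0 : 0 <= m).
    { apply Hub; split; [lra |]; intros r Hr; replace r with 0 by lra; exact H0. }
    assert (Hm1 : m <= t1) by (apply Hleast; intros s [Hs _]; lra).
    assert (Hlt : forall r, 0 <= r < m -> E r < 1).
    { intros r Hr; destruct (Rlt_le_dec (E r) 1) as [Hl | Hl]; [exact Hl | exfalso].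
      assert (m <= r); [| lra].
      apply Hleast; intros s [Hs Hs']; destruct (Rle_lt_dec s r) as [L1 | L1]; [exact L1 |].
      assert (E r < 1) by (apply Hs'; lra); lra. }
    assert (Hge : 1 <= E m).
    { destruct (Rle_lt_dec 1 (E m)) as [Hl | Hl]; [exact Hl | exfalso].
      destruct (continuous_eps E m (1 - E m) (Hc m ltac:(lra)) ltac:(lra)) as (d & Hd & Hn).
      assert (m <> t1) by (intros ->; lra).
      destruct (small2 (d / 2) (t1 - m)) as (r & Hr & Hr1 & Hr2); try lra.
      assert (m + r <= m); [| lra].
      apply Hub; split; [lra |]; intros s Hs.
      destruct (Rlt_le_dec s m); [apply Hlt; lra |].
      assert (B : Rabs (E s - E m) < 1 - E m) by (apply Hn, Rabs_def1; lra).
      apply Rabs_lt_between in B; lra. }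
    exists m; split; [lra |]; split; [exact Hge |].
    intros s Hs; destruct (Rlt_le_dec s m) as [L1 | L1]; [left; apply Hlt; lra |].
    replace s with m by lra.
    destruct (Rle_lt_dec (E m) 1) as [Hl | Hl]; [exact Hl | exfalso].
    destruct (continuous_eps E m (E m - 1) (Hc m ltac:(lra)) ltac:(lra)) as (d & Hd & Hn).
    assert (0 < m) by (destruct (Req_dec m 0) as [Z | Z]; [rewrite Z in Hl; lra | lra]).
    destruct (small2 (d / 2) m) as (r & Hr & Hr1 & Hr2); try lra.
    assert (B : Rabs (E (m - r) - E m) < E m - 1) by (apply Hn, Rabs_def1; lra).
    assert (E (m - r) < 1) by (apply Hlt; lra).
    apply Rabs_lt_between in B; lra.
Qed.

Lemma mean_value (f df : R -> R) (a b : R) :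
  a <= b -> (forall t, a <= t <= b -> is_derive f t (df t)) ->
  exists c, a <= c <= b /\ f b - f a = df c * (b - a).
Proof.
  intros Hab Hf; destruct (MVT_gen f a b df) as [c [Hc E]].
  - intros t Ht; rewrite Rmin_left, Rmax_right in Ht by lra; apply Hf; lra.
  - intros t Ht; rewrite Rmin_left, Rmax_right in Ht by lra.
    apply continuity_pt_filterlim, (ex_derive_continuous f).
    eexists; apply Hf; lra.
  - rewrite Rmin_left, Rmax_right in Hc by lra; eauto.
Qed.

Lemma derive_bound (f df : R -> R) (a b K : R) :
  a <= b -> (forall t, a <= t <= b -> is_derive f t (df t)) ->
  (forall t, a <= t <= b -> Rabs (df t) <= K) ->
  Rabs (f b - f a) <= K * (b - a).
Proof.
  intros Hab Hf HK; destruct (mean_value f df a b Hab Hf) as (c & Hc & E).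
  rewrite E, Rabs_mult, (Rabs_pos_eq (b - a)) by lra.
  apply Rmult_le_compat_r; [lra | apply HK; lra].
Qed.

Lemma derive_nonpos (f df : R -> R) (a b : R) :
  a <= b -> (forall t, a <= t <= b -> is_derive f t (df t)) ->
  (forall t, a <= t <= b -> df t <= 0) -> f b <= f a.
Proof.
  intros Hab Hf HK; destruct (mean_value f df a b Hab Hf) as (c & Hc & E).
  assert (df c <= 0) by (apply HK; lra). nra.
Qed.

Lemma lipschitz_at (f : R -> R) (a : R) : ex_derive f a ->
  exists K d, 0 <= K /\ 0 < d /\
    forall q, Rabs (q - a) < d -> Rabs (f q - f a) <= K * Rabs (q - a).
Proof.
  intros [D HD]; rewrite is_derive_Reals in HD.
  destruct (HD 1 Rlt_0_1) as [d Hd].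
  exists (Rabs D + 1), d; assert (P := Rabs_pos D); split; [lra |]; split; [apply cond_pos |].
  intros q Hq; destruct (Req_dec q a) as [-> | N].
  { rewrite !Rminus_diag, Rabs_R0; lra. }
  assert (Hn : q - a <> 0) by lra.
  specialize (Hd (q - a) Hn Hq); replace (a + (q - a)) with q in Hd by ring.
  replace (f q - f a) with ((f q - f a) / (q - a) * (q - a)) by (field; exact Hn).
  rewrite Rabs_mult; apply Rmult_le_compat_r; [apply Rabs_pos |].
  replace ((f q - f a) / (q - a)) with (D + ((f q - f a) / (q - a) - D)) by ring.
  eapply Rle_trans; [apply Rabs_triang | lra].
Qed.

Lemma derive_pos_increasing_at (f : R -> R) (a D : R) :
  is_derive f a D -> 0 < D ->
  exists d, 0 < d /\ forall s, 0 < s < d -> f a < f (a + s) /\ f (a - s) < f a.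
Proof.
  intros HD Hpos; rewrite is_derive_Reals in HD.
  destruct (HD D Hpos) as [d Hd]; exists d; split; [apply cond_pos |].
  assert (Hq : forall s, s <> 0 -> Rabs s < d -> 0 < (f (a + s) - f a) / s).
  { intros s Hs Hsd; specialize (Hd s Hs Hsd); rabs; lra. }
  intros s Hs; split.
  - assert (P := Hq s ltac:(lra) ltac:(apply Rabs_def1; lra)).
    apply (Rmult_lt_compat_r s) in P; [| lra].
    replace ((f (a + s) - f a) / s * s) with (f (a + s) - f a) in P by (field; lra). lra.
  - assert (P := Hq (- s) ltac:(lra) ltac:(apply Rabs_def1; lra)).
    apply (Rmult_lt_compat_r s) in P; [| lra].
    replace ((f (a + - s) - f a) / - s * s) with (f a - f (a - s)) in P
      by (unfold Rminus; field; lra). lra.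
Qed.

Lemma is_derive_shift (f : R -> R) (s t d : R) :
  is_derive f (t + s) d -> is_derive (fun r => f (r + s)) t d.
Proof.
  intros Hf; replace d with (scal 1 d) by (unfold scal; simpl; unfold mult; simpl; ring).
  apply (is_derive_comp f (fun r => r + s)); [exact Hf | auto_derive; [easy | ring]].
Qed.

Lemma is_derive_glue (f g : R -> R) (a d : R) :
  f a = g a -> is_derive f a d -> is_derive g a d ->
  is_derive (fun t => if Rle_dec t a then f t else g t) a d.
Proof.
  intros E Hf Hg; rewrite is_derive_Reals in *.
  intros e He; destruct (Hf e He) as [d1 H1]; destruct (Hg e He) as [d2 H2].
  assert (Hd : 0 < Rmin d1 d2) by (apply Rmin_case; apply cond_pos).
  exists (mkposreal _ Hd); intros r Hr Hlt; simpl in Hlt.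
  assert (L1 := Rmin_l d1 d2); assert (L2 := Rmin_r d1 d2).
  destruct (Rle_dec a a) as [_ | N]; [| lra].
  destruct (Rle_dec (a + r) a).
  - apply H1; [exact Hr | lra].
  - rewrite E; apply H2; [exact Hr | lra].
Qed.

Lemma abs_RInt_bound (f : R -> R) (a b K : R) :
  a <= b -> (forall t, a <= t <= b -> continuous f t) ->
  (forall t, a <= t <= b -> Rabs (f t) <= K) -> Rabs (RInt f a b) <= (b - a) * K.
Proof.
  intros Hab Hc HK; apply abs_RInt_le_const; [exact Hab | | exact HK].
  apply (ex_RInt_continuous (V := R_CompleteNormedModule)).
  intros t; rewrite Rmin_left, Rmax_right by lra; auto.
Qed.

Lemma RInt_nonneg_zero (f : R -> R) (T : R) :
  (forall t, 0 <= t <= T -> continuous f t) ->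
  (forall t, 0 <= t <= T -> 0 <= f t) ->
  RInt f 0 T <= 0 -> forall t, 0 < t < T -> f t = 0.
Proof.
  intros Hc Hpos HI t Ht.
  destruct (Rle_lt_dec (f t) 0) as [Hle | Hlt];
    [assert (0 <= f t) by (apply Hpos; lra); lra | exfalso].
  destruct (continuous_eps f t (f t / 2) (Hc t ltac:(lra)) ltac:(lra))
    as (d & Hd & Hf).
  destruct (small3 (d / 2) (t / 2) ((T - t) / 2)) as (r & Hr); try lra.
  assert (Hex : forall a b, 0 <= a -> a <= b -> b <= T -> ex_RInt f a b).
  { intros a b Ha Hab Hb; apply (ex_RInt_continuous (V := R_CompleteNormedModule)).
    intros s; rewrite Rmin_left, Rmax_right by lra; intros; apply Hc; lra. }
  assert (P1 : 0 <= RInt f 0 (t - r)).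
  { apply RInt_ge_0; [lra | apply Hex; lra | intros; apply Hpos; lra]. }
  assert (P3 : 0 <= RInt f (t + r) T).
  { apply RInt_ge_0; [lra | apply Hex; lra | intros; apply Hpos; lra]. }
  assert (P2 : RInt (fun _ => f t / 2) (t - r) (t + r) <= RInt f (t - r) (t + r)).
  { apply RInt_le; [lra | apply ex_RInt_const | apply Hex; lra |].
    intros s Hs.
    assert (Hsd : Rabs (s - t) < d) by (apply Rabs_def1; lra).
    assert (B := Hf s Hsd); apply Rabs_lt_between in B; lra. }
  rewrite RInt_const in P2; unfold scal in P2; simpl in P2; unfold mult in P2; simpl in P2.
  assert (C1 : RInt f 0 (t - r) + RInt f (t - r) (t + r) = RInt f 0 (t + r)).
  { apply (RInt_Chasles (V := R_CompleteNormedModule)); apply Hex; lra. }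
  assert (C2 : RInt f 0 (t + r) + RInt f (t + r) T = RInt f 0 T).
  { apply (RInt_Chasles (V := R_CompleteNormedModule)); apply Hex; lra. }
  assert (0 < (t + r - (t - r)) * (f t / 2)) by (apply Rmult_lt_0_compat; lra).
  lra.
Qed.

(** The intervals of integration have different lengths because the perturbed orbit returns at
    its own time; [B] controls the part where only one of the integrands is defined. *)
Lemma RInt_compare (f g : R -> R) (T1 T2 eta B : R) :
  0 <= T1 -> 0 <= T2 ->
  (forall t, 0 <= t <= T1 -> continuous f t /\ Rabs (f t) <= B) ->
  (forall t, 0 <= t <= T2 -> continuous g t /\ Rabs (g t) <= B) ->
  (forall t, 0 <= t <= T1 -> t <= T2 -> Rabs (f t - g t) <= eta) ->
  Rabs (RInt f 0 T1 - RInt g 0 T2) <= T2 * eta + Rabs (T1 - T2) * B.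
Proof.
  intros HT1 HT2 Hf Hg Hfg.
  assert (Heta : 0 <= eta)
    by (eapply Rle_trans; [apply Rabs_pos | apply (Hfg 0); lra]).
  set (tau := Rmin T1 T2).
  assert (Htau : 0 <= tau /\ tau <= T1 /\ tau <= T2).
  { unfold tau; repeat split; [apply Rmin_case; lra | apply Rmin_l | apply Rmin_r]. }
  assert (Hexf : forall a b, 0 <= a -> a <= b -> b <= T1 -> ex_RInt f a b).
  { intros a b Ha Hab Hb; apply (ex_RInt_continuous (V := R_CompleteNormedModule)).
    intros s; rewrite Rmin_left, Rmax_right by lra; intros; apply Hf; lra. }
  assert (Hexg : forall a b, 0 <= a -> a <= b -> b <= T2 -> ex_RInt g a b).
  { intros a b Ha Hab Hb; apply (ex_RInt_continuous (V := R_CompleteNormedModule)).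
    intros s; rewrite Rmin_left, Rmax_right by lra; intros; apply Hg; lra. }
  assert (Cf : RInt f 0 tau + RInt f tau T1 = RInt f 0 T1).
  { apply (RInt_Chasles (V := R_CompleteNormedModule)); apply Hexf; lra. }
  assert (Cg : RInt g 0 tau + RInt g tau T2 = RInt g 0 T2).
  { apply (RInt_Chasles (V := R_CompleteNormedModule)); apply Hexg; lra. }
  assert (D : RInt (fun t => f t - g t) 0 tau = RInt f 0 tau - RInt g 0 tau).
  { apply (RInt_minus (V := R_CompleteNormedModule)); [apply Hexf | apply Hexg]; lra. }
  assert (B1 : Rabs (RInt (fun t => f t - g t) 0 tau) <= (tau - 0) * eta).
  { apply abs_RInt_bound; [lra | |].
    - intros t Ht; apply (continuous_minus (V := R_NormedModule)); [apply Hf | apply Hg]; lra.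
    - intros t Ht; apply Hfg; lra. }
  assert (B2 : Rabs (RInt f tau T1) <= (T1 - tau) * B)
    by (apply abs_RInt_bound; [lra | |]; intros t Ht; apply Hf; lra).
  assert (B3 : Rabs (RInt g tau T2) <= (T2 - tau) * B)
    by (apply abs_RInt_bound; [lra | |]; intros t Ht; apply Hg; lra).
  rewrite <- Cf, <- Cg.
  replace (RInt f 0 tau + RInt f tau T1 - (RInt g 0 tau + RInt g tau T2))
    with (RInt (fun t => f t - g t) 0 tau + (RInt f tau T1 - RInt g tau T2))
    by (rewrite D; to_R; ring).
  eapply Rle_trans; [apply Rabs_triang |].
  assert (T3 : Rabs (RInt f tau T1 - RInt g tau T2)
            <= Rabs (RInt f tau T1) + Rabs (RInt g tau T2)).
  { unfold Rminus; eapply Rle_trans; [apply Rabs_triang |]; rewrite Rabs_Ropp; lra. }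
  assert (E : (T1 - tau) * B + (T2 - tau) * B = Rabs (T1 - T2) * B).
  { unfold tau, Rmin; destruct (Rle_dec T1 T2).
    - rewrite Rabs_left1 by lra; ring.
    - rewrite Rabs_pos_eq by lra; ring. }
  assert ((tau - 0) * eta <= T2 * eta) by (apply Rmult_le_compat_r; lra).
  lra.
Qed.

(** * Limits at zero and power series *)

(** The point 0 is excluded since the functions of interest are divided by powers of their
    argument. *)
Definition tends (f : R -> R) (l : R) : Prop := filterlim f (locally' 0) (locally l).

Lemma tends_eps (f : R -> R) (l e : R) :
  tends f l -> 0 < e -> locally' 0 (fun t => Rabs (f t - l) < e).
Proof.
  intros Hf He; exact (proj1 (filterlim_locally f l) Hf (mkposreal e He)).
Qed.

Lemma tends_ext (f g : R -> R) (l : R) :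
  locally' 0 (fun t => f t = g t) -> tends f l -> tends g l.
Proof. apply filterlim_ext_loc. Qed.

Lemma tends_const (a : R) : tends (fun _ => a) a.
Proof. apply filterlim_const. Qed.

Lemma tends_id : tends (fun e => e) 0.
Proof.
  intros P HP; revert HP; unfold filtermap; apply filter_le_within.
Qed.

Lemma tends_plus (f g : R -> R) (a b : R) :
  tends f a -> tends g b -> tends (fun e => f e + g e) (a + b).
Proof.
  intros Hf Hg; eapply filterlim_comp_2; [exact Hf | exact Hg |].
  apply (filterlim_plus (V := R_NormedModule) a b).
Qed.

Lemma tends_mult (f g : R -> R) (a b : R) :
  tends f a -> tends g b -> tends (fun e => f e * g e) (a * b).
Proof.
  intros Hf Hg; eapply filterlim_comp_2; [exact Hf | exact Hg |].
  apply (filterlim_mult (K := R_AbsRing) a b).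
Qed.

Lemma tends_pow (f : R -> R) (a : R) (n : nat) :
  tends f a -> tends (fun e => f e ^ n) (a ^ n).
Proof.
  intros Hf; induction n as [| n IH]; simpl; [apply tends_const | apply tends_mult; auto].
Qed.

Lemma tends_abs (f : R -> R) (a : R) : tends f a -> tends (fun e => Rabs (f e)) (Rabs a).
Proof. intros Hf; eapply filterlim_comp; [exact Hf | apply continuous_Rabs]. Qed.

Lemma tends_dominated (f g : R -> R) :
  locally' 0 (fun e => Rabs (f e) <= g e) -> tends g 0 -> tends f 0.
Proof.
  intros Hfg Hg; apply filterlim_locally; intros [eta Heta].
  generalize (filter_and (F := locally' 0) _ _ Hfg (tends_eps g 0 eta Hg Heta)).
  apply filter_imp; intros e [E1 E2]; simpl.
  unfold ball; simpl; unfold AbsRing_ball, abs, minus, plus, opp; simpl.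
  rewrite Ropp_0, Rplus_0_r; rabs; apply Rabs_def1; lra.
Qed.

Lemma locally'_0_witness (P : R -> Prop) : locally' 0 P -> exists r, P r.
Proof.
  intros [d Hd]; exists (d / 2); assert (Hp := cond_pos d); apply Hd; [| lra].
  unfold ball; simpl; unfold AbsRing_ball, abs, minus, plus, opp; simpl.
  apply Rabs_def1; lra.
Qed.

Lemma locally_0_nonzero (P : R -> Prop) :
  locally 0 P -> exists r, r <> 0 /\ P r.
Proof.
  intros [d Hd]; exists (d / 2); assert (Hp := cond_pos d); split; [lra |].
  apply Hd; unfold ball; simpl; unfold AbsRing_ball, abs, minus, plus, opp; simpl.
  apply Rabs_def1; lra.
Qed.

Lemma tends_unique (f : R -> R) (a b : R) : tends f a -> tends f b -> a = b.
Proof.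
  intros Ha Hb; destruct (Req_dec a b) as [E | N]; [exact E | exfalso].
  assert (He : 0 < Rabs (a - b) / 2) by (assert (P := Rabs_pos_lt (a - b)); lra).
  destruct (locally'_0_witness _
    (filter_and _ _ (tends_eps f a _ Ha He) (tends_eps f b _ Hb He))) as (r & H1 & H2).
  rewrite Rabs_minus_sym in H1.
  assert (P := Rabs_triang (a - f r) (f r - b)).
  replace (a - f r + (f r - b)) with (a - b) in P by ring. lra.
Qed.

(** Analyticity and expansions are stated as convergence near the centre; a positive radius
    turns this into continuity and differentiability of the sum. *)
Lemma radius_pos (a : nat -> R) (r : R) :
  r <> 0 -> ex_pseries a r -> Rbar_lt 0 (CV_radius a).
Proof.
  intros Hr Hex.
  apply Rbar_lt_le_trans with (Rabs r); [apply Rabs_pos_lt, Hr |].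
  apply Rbar_not_lt_le; intros Hlt; apply (CV_disk_outside a r Hlt).
  apply ex_series_lim_0, ex_pseries_R, Hex.
Qed.

Lemma analytic_ex_derive (f : R -> R) (h : R) : analytic_at f h -> ex_derive f h.
Proof.
  intros [a Ha].
  assert (Hrad : Rbar_lt 0 (CV_radius a)).
  { destruct Ha as [d Hd]; assert (Hp := cond_pos d).
    apply (radius_pos a (d / 2)); [lra |].
    assert (Hs : is_pseries a (h + d / 2 - h) (f (h + d / 2))).
    2: { replace (h + d / 2 - h) with (d / 2) in Hs by ring; eexists; exact Hs. }
    apply Hd; unfold ball; simpl; unfold AbsRing_ball, abs, minus, plus, opp; simpl.
    apply Rabs_def1; lra. }
  apply (ex_derive_ext_loc (fun t => PSeries a (t - h))).
  - revert Ha; apply filter_imp; intros t Ht; apply is_pseries_unique, Ht.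
  - apply (ex_derive_comp (PSeries a) (fun t => t - h)).
    + apply ex_derive_PSeries; rewrite Rminus_diag, Rabs_R0; exact Hrad.
    + auto_derive; easy.
Qed.

Lemma expansion_pseries (c : nat -> R) (f : R -> R) :
  expansion c f ->
  let b := fun k => match k with O => 0 | S _ => c k end in
  (exists r, r <> 0 /\ ex_pseries b r) /\ locally 0 (fun e => f e = PSeries b e).
Proof.
  intros Hf b.
  assert (Hb : locally 0 (fun e => is_pseries b e (f e))).
  { unfold expansion in Hf; revert Hf; apply filter_imp; intros e He; apply is_pseries_R.
    apply (is_series_decr_1 (K := R_AbsRing) (V := R_NormedModule)).
    match goal with |- is_series _ ?l => replace l with (f e) end; [exact He |].
    unfold plus, opp, b; simpl; ring. }
  split.
  - destruct (locally_0_nonzero _ Hb) as (r & Hr & Hs).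
    exists r; split; [exact Hr | eexists; exact Hs].
  - revert Hb; apply filter_imp; intros e He; symmetry; apply is_pseries_unique, He.
Qed.

Lemma expansion_at_0 (c : nat -> R) (f : R -> R) : expansion c f -> f 0 = 0.
Proof.
  intros Hf; destruct (expansion_pseries c f Hf) as [_ Hl].
  rewrite (locally_singleton _ _ Hl), PSeries_0; reflexivity.
Qed.

Lemma expansion_lead (c : nat -> R) (f : R -> R) (n : nat) :
  expansion c f -> (1 <= n)%nat -> (forall k, (1 <= k < n)%nat -> c k = 0) ->
  tends (fun e => f e / e ^ n) (c n).
Proof.
  intros Hf Hn Hk; destruct (expansion_pseries c f Hf) as [(r & Hr & Hex) Hl].
  set (b := fun k => match k with O => 0 | S _ => c k end) in *.
  assert (Hb : forall k, (k < n)%nat -> b k = 0).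
  { intros [| k] Hkn; [reflexivity | apply Hk; lia]. }
  assert (Hrad : Rbar_lt 0 (CV_radius (PS_decr_n b n))).
  { apply (radius_pos _ r Hr).
    apply (ex_pseries_decr_n (K := R_AbsRing) (V := R_NormedModule)); [| exact Hex].
    right; exists (/ r); unfold mult, one; simpl; field; exact Hr. }
  apply (tends_ext (PSeries (PS_decr_n b n))).
  - destruct Hl as [d Hd]; exists d; intros e He Hne.
    rewrite (Hd e He), (PSeries_decr_n_aux b n e Hb); field; apply pow_nonzero, Hne.
  - replace (c n) with (PSeries (PS_decr_n b n) 0)
      by (rewrite PSeries_0; unfold PS_decr_n; rewrite Nat.add_0_r; destruct n; [lia | easy]).
    assert (Hc : continuity_pt (PSeries (PS_decr_n b n)) 0)
      by (apply PSeries_continuity; rewrite Rabs_R0; exact Hrad).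
    apply continuity_pt_filterlim in Hc.
    intros P HP; apply (filter_le_within (F := locally 0)), Hc, HP.
Qed.

Lemma expansion_tends_0 (c : nat -> R) (f : R -> R) : expansion c f -> tends f 0.
Proof.
  intros Hf.
  assert (H1 := expansion_lead c f 1 Hf (le_n 1) ltac:(intros; lia)).
  apply (tends_ext (fun e => f e / e ^ 1 * e)).
  - exists (mkposreal 1 Rlt_0_1); intros e _ He; field; exact He.
  - replace 0 with (c 1%nat * 0) by ring; apply tends_mult; [exact H1 | apply tends_id].
Qed.

Lemma expansion_lin (c1 c2 : nat -> R) (f1 f2 : R -> R) (a : R) :
  expansion c1 f1 -> expansion c2 f2 ->
  expansion (fun k => c1 k + a * c2 k) (fun e => f1 e + a * f2 e).
Proof.
  unfold expansion; intros H1 H2.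
  generalize (filter_and (F := locally 0) _ _ H1 H2); apply filter_imp.
  intros e [E1 E2].
  apply (is_series_ext (fun k => plus (c1 (S k) * e ^ S k) (scal a (c2 (S k) * e ^ S k)))).
  - intros k; unfold plus, scal; simpl; unfold mult; simpl; ring.
  - apply (is_series_plus (K := R_AbsRing) (V := R_NormedModule)); [exact E1 |].
    apply (is_series_scal (K := R_AbsRing) (V := R_NormedModule) a _ _ E2).
Qed.

(** * The perturbed vector field *)

Definition friction (l : nat -> R) (x y : R) : R :=
  l 1%nat + l 2%nat * x ^ 2 + l 3%nat * y ^ 2 + l 4%nat * x ^ 4
  + l 5%nat * y ^ 4 + l 6%nat * x ^ 6.

Lemma Xx_eq (l : nat -> R) (x y : R) : Xx l x y = y.
Proof.
  unfold Xx; apply is_derive_unique; unfold H; auto_derive; [easy | field].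
Qed.

Lemma Xy_eq (l : nat -> R) (x y : R) :
  Xy l x y = - x + x ^ 3 + friction l x y * y.
Proof.
  unfold Xy, friction.
  replace (Derive (fun u => H u y) x) with (x - x ^ 3); [ring |].
  symmetry; apply is_derive_unique; unfold H; auto_derive; [easy | field].
Qed.

Lemma trajectory_derive (l : nat -> R) (T : R) (x y : R -> R) :
  trajectory l T x y <->
  (forall t, 0 <= t <= T ->
    is_derive x t (y t) /\
    is_derive y t (- x t + x t ^ 3 + friction l (x t) (y t) * y t)).
Proof.
  split; intros Htr t Ht; specialize (Htr t Ht);
    rewrite Xx_eq, Xy_eq in *; exact Htr.
Qed.

Lemma friction_zero (x y : R) : friction (fun _ => 0) x y = 0.
Proof. unfold friction; ring. Qed.

Lemma trajectory_derive_0 (T : R) (x y : R -> R) :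
  trajectory (fun _ => 0) T x y <->
  (forall t, 0 <= t <= T ->
    is_derive x t (y t) /\ is_derive y t (- x t + x t ^ 3)).
Proof.
  rewrite trajectory_derive.
  split; intros Htr t Ht; specialize (Htr t Ht); rewrite friction_zero in *;
    replace (- x t + x t ^ 3 + 0 * y t) with (- x t + x t ^ 3) in * by ring;
    exact Htr.
Qed.

Lemma trajectory_shift (l : nat -> R) (T s : R) (x y : R -> R) :
  0 <= s <= T -> trajectory l T x y ->
  trajectory l (T - s) (fun t => x (t + s)) (fun t => y (t + s)).
Proof.
  intros Hs; rewrite !trajectory_derive; intros Htr t Ht.
  destruct (Htr (t + s)) as [Hx Hy]; [lra |].
  split; apply is_derive_shift; assumption.
Qed.

Ltac subst_derive Hx :=
  match type of Hx with is_derive ?x ?t ?v =>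
    let E := fresh in
    assert (E : Derive (fun s => x s) t = v) by (apply is_derive_unique; exact Hx);
    rewrite ?E; clear E
  end.

Ltac derive_along Hx Hy :=
  auto_derive;
  [ repeat split; solve [easy | eexists; exact Hx | eexists; exact Hy]
  | subst_derive Hx; subst_derive Hy ].

Ltac continuous_along Hx Hy :=
  apply (ex_derive_continuous (K := R_AbsRing) (V := R_NormedModule)); auto_derive;
  repeat split; solve [easy | eexists; exact Hx | eexists; exact Hy].

Lemma H_along (l : nat -> R) (T : R) (x y : R -> R) :
  trajectory l T x y -> forall t, 0 <= t <= T ->
  is_derive (fun s => H (x s) (y s)) t (friction l (x t) (y t) * y t ^ 2).
Proof.
  rewrite trajectory_derive; intros Htr t Ht; destruct (Htr t Ht) as [Hx Hy].
  unfold H; derive_along Hx Hy; field.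
Qed.

Lemma energy_conserved (T : R) (x y : R -> R) :
  trajectory (fun _ => 0) T x y -> forall t, 0 <= t <= T ->
  H (x t) (y t) = H (x 0) (y 0).
Proof.
  intros Htr t Ht.
  assert (B := derive_bound (fun s => H (x s) (y s)) (fun _ => 0) 0 t 0).
  simpl in B.
  assert (Habs : Rabs (H (x t) (y t) - H (x 0) (y 0)) <= 0).
  { rewrite Rmult_0_l in B; apply B; [lra | | intros; rewrite Rabs_R0; lra].
    intros s Hs.
    replace 0 with (friction (fun _ => 0) (x s) (y s) * y s ^ 2)
      by (rewrite friction_zero; ring).
    eapply H_along; [exact Htr | lra]. }
  assert (Hp := Rabs_pos (H (x t) (y t) - H (x 0) (y 0))).
  destruct (Req_dec (H (x t) (y t) - H (x 0) (y 0)) 0) as [E | E]; [lra |].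
  apply Rabs_no_R0 in E; lra.
Qed.

Lemma oval_bounds (h x y : R) : h < 1 / 4 -> oval h x y ->
  -1 < y < 1 /\ x ^ 2 <= 4 * h /\ y ^ 2 <= 2 * h.
Proof.
  intros Hh [E Hx]; unfold H in E.
  assert (0 <= x ^ 2 <= 1) by nra.
  replace (x ^ 4) with (x ^ 2 * x ^ 2) in E by ring.
  assert (x ^ 2 * x ^ 2 <= x ^ 2) by nra.
  assert (0 <= y ^ 2) by nra.
  assert (y ^ 2 <= 2 * h) by lra.
  split; [nra | split; [lra | lra]].
Qed.

Lemma cubic_bound (x : R) : -1 < x < 1 -> -1 <= - x + x ^ 3 <= 1.
Proof.
  intros Hx; assert (0 <= 1 - x ^ 2 <= 1) by (split; nra).
  replace (- x + x ^ 3) with (- x * (1 - x ^ 2)) by ring; split; nra.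
Qed.

Lemma oval_param_derive (h T : R) (x y : R -> R) :
  oval_param h T x y -> forall t, 0 <= t <= T ->
  is_derive x t (y t) /\ is_derive y t (- x t + x t ^ 3) /\ H (x t) (y t) = h.
Proof.
  intros (_ & Htr & Ho & _) t Ht; rewrite trajectory_derive_0 in Htr.
  destruct (Htr t Ht); destruct (Ho t Ht); auto.
Qed.

Lemma oval_param_box (h T : R) (x y : R -> R) :
  h < 1 / 4 -> oval_param h T x y ->
  forall t, 0 <= t <= T -> Rabs (x t) <= 1 /\ Rabs (y t) <= 1.
Proof.
  intros Hh (_ & _ & Ho & _) t Ht.
  destruct (oval_bounds h (x t) (y t) Hh (Ho t Ht)) as (Hy & _).
  destruct (Ho t Ht) as [_ Hx]; split; apply Rabs_le; lra.
Qed.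

(** * Integrals over the ovals *)

(** The friction polynomial whose product with [y ^ 2] is the derivative of [x y ^ 3] along
    [X_0]. *)
Definition exact_friction (x y : R) : R := y ^ 2 - 3 * x ^ 2 + 3 * x ^ 4.

(** A primitive of [x y ^ 3 exact_friction] along [X_0].  It is found by dividing by [y = x'],
    integrating in [x] after the substitution [y ^ 2 = 2 H - x ^ 2 + x ^ 4 / 2], with [H] held
    constant. *)
Definition secondary (x y : R) : R :=
  x ^ 2 * y ^ 4 / 2 - x ^ 4 * y ^ 2 / 4 + x ^ 6 * y ^ 2 / 6
  - x ^ 6 / 12 + 5 / 48 * x ^ 8 - x ^ 10 / 30.

(** The partial derivative of [secondary] in [y], divided by [y]; equivalently, the derivative
    of that primitive with respect to the constant [H]. *)
Definition secondary_rate (x y : R) : R := 2 * x ^ 2 * y ^ 2 - x ^ 4 / 2 + x ^ 6 / 3.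

(** The coefficients of [f - lambda_3 exact_friction]. *)
Definition reduced (l : nat -> R) (j : nat) : R :=
  match j with
  | 2%nat => l 2%nat + 3 * l 3%nat
  | 3%nat => 0
  | 4%nat => l 4%nat - 3 * l 3%nat
  | _ => l j
  end.

Lemma friction_reduced (l : nat -> R) (x y : R) :
  friction l x y = l 3%nat * exact_friction x y + friction (reduced l) x y.
Proof. unfold friction, exact_friction, reduced; ring. Qed.

Definition melnikov_integrand (kappa : R) (g : nat -> R) (x y : R) : R :=
  kappa * (3 * exact_friction x y * secondary_rate x y * y ^ 2) + friction g x y * y ^ 2.

Lemma ex_RInt_along (F : R -> R -> R) (T : R) (x y : R -> R) :
  0 <= T ->
  (forall t, 0 <= t <= T -> continuous (fun s => F (x s) (y s)) t) ->
  ex_RInt (fun t => F (x t) (y t)) 0 T.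
Proof.
  intros HT Hc; apply (ex_RInt_continuous (V := R_CompleteNormedModule)).
  intros t; rewrite Rmin_left, Rmax_right by lra; auto.
Qed.

Lemma closed_integral (h T : R) (x y : R -> R) (F Phi : R -> R -> R) :
  oval_param h T x y ->
  (forall t, 0 <= t <= T ->
    is_derive (fun s => Phi (x s) (y s)) t (F (x t) (y t))) ->
  (forall t, 0 <= t <= T -> continuous (fun s => F (x s) (y s)) t) ->
  is_RInt (fun t => F (x t) (y t)) 0 T 0.
Proof.
  intros (HT & _ & _ & Ex & Ey & _) HPhi Hc.
  replace 0 with (minus (Phi (x T) (y T)) (Phi (x 0) (y 0))) at 2
    by (rewrite Ex, Ey; unfold minus, plus, opp; simpl; ring).
  apply (is_RInt_derive (fun s => Phi (x s) (y s)));
    intros t; rewrite Rmin_left, Rmax_right by lra; auto.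
Qed.

Lemma cohomologous_integral (h T : R) (x y : R -> R) (F G Phi : R -> R -> R) :
  oval_param h T x y ->
  (forall t, 0 <= t <= T ->
    is_derive (fun s => Phi (x s) (y s)) t (F (x t) (y t) - G (x t) (y t))) ->
  (forall t, 0 <= t <= T -> continuous (fun s => F (x s) (y s)) t) ->
  (forall t, 0 <= t <= T -> continuous (fun s => G (x s) (y s)) t) ->
  RInt (fun t => F (x t) (y t)) 0 T = RInt (fun t => G (x t) (y t)) 0 T.
Proof.
  intros Hp HPhi HF HG.
  assert (HT : 0 <= T) by (destruct Hp; lra).
  assert (E : is_RInt (fun t => F (x t) (y t) - G (x t) (y t)) 0 T 0).
  { apply (closed_integral h T x y (fun u v => F u v - G u v) Phi); auto.
    intros t Ht; apply (continuous_minus (V := R_NormedModule)); auto. }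
  apply (is_RInt_unique (V := R_CompleteNormedModule)) in E.
  assert (E2 := RInt_minus (fun t => F (x t) (y t)) (fun t => G (x t) (y t)) 0 T
    (ex_RInt_along F T x y HT HF) (ex_RInt_along G T x y HT HG)).
  unfold minus, plus, opp in E2; simpl in E2.
  assert (E3 : RInt (fun t => F (x t) (y t) + - G (x t) (y t)) 0 T = 0) by exact E.
  lra.
Qed.

(** Both sides have the same normal form [p (x ^ 2) y ^ 2] under the integration by parts
    [x ^ k y ^ (2 j + 2) = (2 j + 1) / (k + 1) (x ^ (k + 2) - x ^ (k + 4)) y ^ (2 j)] modulo the
    derivative of [x ^ (k + 1) y ^ (2 j + 1) / (k + 1)], once [h] is replaced by [H x y]. *)
Lemma melnikov_L_form (h T : R) (x y : R -> R) (kappa : R) (c : nat -> nat -> R)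
  (n : nat) :
  oval_param h T x y ->
  let I0 := RInt (fun t => y t ^ 2) 0 T in
  let I2 := RInt (fun t => x t ^ 2 * y t ^ 2) 0 T in
  RInt (fun t => melnikov_integrand kappa (reduced (fun j => c j n)) (x t) (y t)) 0 T
  = L c n h I0 I2 - 8 / 1001 * kappa *
      ((308 * h ^ 2 - 181 * h + 24) * I2 + (80 * h ^ 2 - 12 * h) * I0).
Proof.
  intros Hp I0 I2.
  assert (HT : 0 <= T) by (destruct Hp; lra).
  assert (Hd := oval_param_derive h T x y Hp).
  set (A := - (4 / 3 * c 6%nat n + 320 / 231 * c 5%nat n) * h
   + (32 / 21 * c 6%nat n + 40 / 231 * c 5%nat n + 8 / 7 * c 4%nat n
      - 3 / 7 * c 3%nat n + c 2%nat n)
   - 8 / 1001 * kappa * (308 * h ^ 2 - 181 * h + 24)).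
  set (B := 240 / 77 * c 5%nat n * h ^ 2
     - (16 / 21 * c 6%nat n + 20 / 231 * c 5%nat n + 4 / 7 * c 4%nat n
        - 12 / 7 * c 3%nat n) * h
     + c 1%nat n - 8 / 1001 * kappa * (80 * h ^ 2 - 12 * h)).
  assert (HI : is_RInt (fun t => A * (x t ^ 2 * y t ^ 2) + B * y t ^ 2) 0 T
                 (A * I2 + B * I0)).
  { apply (is_RInt_plus (V := R_NormedModule) (fun t => A * (x t ^ 2 * y t ^ 2))
      (fun t => B * y t ^ 2)).
    - apply (is_RInt_scal (V := R_NormedModule) (fun t => x t ^ 2 * y t ^ 2)).
      apply (RInt_correct (V := R_CompleteNormedModule)),
        (ex_RInt_along (fun u v => u ^ 2 * v ^ 2)); [lra |].
      intros t Ht; destruct (Hd t Ht) as (Hx & Hy & _); continuous_along Hx Hy.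
    - apply (is_RInt_scal (V := R_NormedModule) (fun t => y t ^ 2)).
      apply (RInt_correct (V := R_CompleteNormedModule)),
        (ex_RInt_along (fun u v => v ^ 2) T x y); [exact HT |].
      intros t Ht; destruct (Hd t Ht) as (Hx & Hy & _); continuous_along Hx Hy. }
  apply (is_RInt_unique (V := R_CompleteNormedModule)) in HI.
  transitivity (A * I2 + B * I0); [rewrite <- HI | unfold A, B, L; to_R; ring].
  apply (cohomologous_integral h T x y
    (melnikov_integrand kappa (reduced (fun j => c j n)))
    (fun u v => A * (u ^ 2 * v ^ 2) + B * v ^ 2)
    (fun u v =>
       kappa * (-48 / 1001 * (u * v ^ 3) + 160 / 1001 * (u * v ^ 5)
         + 12 / 91 * (u ^ 3 * v ^ 3) + 86 / 39 * (u ^ 3 * v ^ 5)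
         - 9853 / 6006 * (u ^ 5 * v ^ 3) + 41 / 39 * (u ^ 7 * v ^ 3))
       - 6 / 7 * c 3%nat n * (u * v ^ 3) + 2 / 7 * c 4%nat n * (u * v ^ 3)
       + c 5%nat n * (17 / 77 * (u * v ^ 5) + 5 / 63 * (u ^ 3 * v ^ 3)
           - 5 / 77 * (u ^ 5 * v ^ 3) + 10 / 231 * (u * v ^ 3))
       + c 6%nat n * (2 / 9 * (u ^ 3 * v ^ 3) + 8 / 21 * (u * v ^ 3))));
    [exact Hp | | |]; intros t Ht; destruct (Hd t Ht) as (Hx & Hy & E).
  - derive_along Hx Hy.
    unfold A, B, melnikov_integrand, friction, reduced, exact_friction, secondary_rate.
    rewrite <- E; unfold H; field.
  - unfold melnikov_integrand, friction, exact_friction, secondary_rate; continuous_along Hx Hy.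
  - continuous_along Hx Hy.
Qed.

Fixpoint horner (l : list R) (s : R) : R :=
  match l with nil => 0 | a :: l' => a + s * horner l' s end.

(** The normal form under the integration by parts of [melnikov_L_form], from which the
    coefficients can be recovered: the map from [kappa] and [g] to the six coefficients below
    is injective. *)
Lemma melnikov_even_form (h T : R) (x y : R -> R) (kappa : R) (g : nat -> R) :
  oval_param h T x y -> g 3%nat = 0 ->
  RInt (fun t => melnikov_integrand kappa g (x t) (y t)) 0 T
  = RInt (fun t => horner (g 1%nat :: g 2%nat :: g 4%nat + 5 * g 5%nat
      :: g 6%nat - 8 * g 5%nat - 6 / 5 * kappa
      :: 3 * g 5%nat + 72 / 35 * kappa :: - (6 / 7) * kappa :: nil)
      (x t ^ 2) * y t ^ 2) 0 T.
Proof.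
  intros Hp E3.
  assert (Hd := oval_param_derive h T x y Hp).
  apply (cohomologous_integral h T x y (melnikov_integrand kappa g)
    (fun u v => horner (g 1%nat :: g 2%nat :: g 4%nat + 5 * g 5%nat
      :: g 6%nat - 8 * g 5%nat - 6 / 5 * kappa
      :: 3 * g 5%nat + 72 / 35 * kappa :: - (6 / 7) * kappa :: nil)
      (u ^ 2) * v ^ 2)
    (fun u v => kappa * (2 * (u ^ 3 * v ^ 5) - 19 / 10 * (u ^ 5 * v ^ 3)
         + 9 / 7 * (u ^ 7 * v ^ 3))
       + g 5%nat * (u * v ^ 5 + 5 / 3 * (u ^ 3 * v ^ 3) - u ^ 5 * v ^ 3)));
    [exact Hp | | |]; intros t Ht; destruct (Hd t Ht) as (Hx & Hy & _).
  - derive_along Hx Hy.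
    unfold melnikov_integrand, friction, exact_friction, secondary_rate, horner.
    rewrite E3; field.
  - unfold melnikov_integrand, friction, exact_friction, secondary_rate; continuous_along Hx Hy.
  - simpl; continuous_along Hx Hy.
Qed.

Lemma oval_moment_pos (h T : R) (x y : R -> R) (k : nat) :
  0 < h < 1 / 4 -> oval_param h T x y ->
  0 < RInt (fun t => (x t ^ 2) ^ k * y t ^ 2) 0 T.
Proof.
  intros Hh Hp.
  assert (Hd := oval_param_derive h T x y Hp).
  assert (HT : 0 < T) by (destruct Hp; lra).
  apply Rnot_le_lt; intros Hle.
  assert (Hz : forall t, 0 < t < T -> (x t ^ 2) ^ k * y t ^ 2 = 0).
  { apply RInt_nonneg_zero with (f := fun t => (x t ^ 2) ^ k * y t ^ 2).
    - intros t Ht; destruct (Hd t Ht) as (Hx & Hy & _).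
      continuous_along Hx Hy.
    - intros t Ht; apply Rmult_le_pos; [apply pow_le |]; apply pow2_ge_0.
    - exact Hle. }
  assert (Hxy : forall t, 0 < t < T -> x t * y t = 0).
  { intros t Ht; specialize (Hz t Ht).
    apply Rmult_integral in Hz; destruct Hz as [E | E].
    - destruct k; [simpl in E; lra |].
      destruct (Req_dec (x t) 0) as [-> | N]; [ring |].
      exfalso; apply (pow_nonzero (x t ^ 2) (S k)); [apply pow_nonzero |]; assumption.
    - destruct (Req_dec (y t) 0) as [-> | N]; [ring |].
      exfalso; apply (pow_nonzero (y t) 2); assumption. }
  destruct (Hd (T / 2) ltac:(lra)) as (Hx & Hy & E).
  (* Where [x y = 0] on an interval, its derivative [y ^ 2 - x ^ 2 + x ^ 4] vanishes as well; for
     [-1 < x < 1] both vanish only at the origin, which lies on no oval. *)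
  assert (D1 : is_derive (fun t => x t * y t) (T / 2)
            (y (T / 2) ^ 2 - x (T / 2) ^ 2 + x (T / 2) ^ 4)).
  { derive_along Hx Hy; ring. }
  assert (D2 : is_derive (fun t => x t * y t) (T / 2) 0).
  { apply (is_derive_ext_loc (fun _ => 0)); [| apply (is_derive_const 0)].
    exists (mkposreal (T / 2) ltac:(lra)); intros t Ht.
    unfold ball in Ht; simpl in Ht; unfold AbsRing_ball, abs, minus, plus, opp in Ht;
      simpl in Ht; apply Rabs_lt_between in Ht.
    symmetry; apply Hxy; lra. }
  apply is_derive_unique in D1; apply is_derive_unique in D2; rewrite D1 in D2.
  specialize (Hxy (T / 2) ltac:(lra)).
  destruct Hp as (_ & _ & Ho & _); destruct (Ho (T / 2) ltac:(lra)) as [_ Hlt].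
  set (X := x (T / 2)) in *; set (Y := y (T / 2)) in *.
  unfold H in E.
  apply Rmult_integral in Hxy; destruct Hxy as [Z | Z]; rewrite Z in *; [nra |].
  assert (X ^ 2 * (1 - X ^ 2) = 0) by nra.
  assert (X ^ 2 = 0) by nra. nra.
Qed.

Lemma horner_bound (l : list R) :
  exists B, 0 <= B /\ forall s, 0 <= s <= 1 -> Rabs (horner l s) <= B.
Proof.
  induction l as [| a l (B & HB & IH)]; simpl.
  - exists 0; split; [lra |]; intros; rewrite Rabs_R0; lra.
  - exists (Rabs a + B); split; [assert (P := Rabs_pos a); lra |].
    intros s Hs; eapply Rle_trans; [apply Rabs_triang |].
    rewrite Rabs_mult, (Rabs_pos_eq s) by lra.
    specialize (IH s Hs); assert (P := Rabs_pos (horner l s)); nra.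
Qed.

Lemma continuous_horner (l : list R) (f : R -> R) (t : R) :
  continuous f t -> continuous (fun s => horner l (f s)) t.
Proof.
  intros Hf; induction l as [| a l IH]; simpl; [apply continuous_const |].
  apply (continuous_plus (V := R_NormedModule)); [apply continuous_const |].
  apply (continuous_mult (K := R_AbsRing)); assumption.
Qed.

(** On the oval of level [h] one has [x ^ 2 <= 4 h], so for small [h] the polynomial has the sign
    of its lowest nonzero coefficient on the whole oval and its integral cannot vanish.  The
    factor [(x ^ 2) ^ k] lets the induction strip the coefficients one at a time. *)
Lemma even_polynomial_zero (l : list R) (k : nat) :
  (forall h, 0 < h < 1 / 4 -> exists T x y, oval_param h T x y /\
    RInt (fun t => (x t ^ 2) ^ k * horner l (x t ^ 2) * y t ^ 2) 0 T = 0) ->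
  List.Forall (fun a => a = 0) l.
Proof.
  revert k; induction l as [| a l IH]; intros k Hk; [constructor |].
  assert (Ea : a = 0).
  { destruct (Req_dec a 0) as [E | N]; [exact E | exfalso].
    destruct (horner_bound l) as (B & HB & Hl).
    assert (Ha : 0 < Rabs a) by (apply Rabs_pos_lt; exact N).
    (* This level makes [x ^ 2 * horner l (x ^ 2)] at most half of [a] in absolute value. *)
    set (h := Rmin (1 / 8) (Rabs a / (8 * (B + 1)))).
    assert (Hq : 0 < Rabs a / (8 * (B + 1))) by (apply Rdiv_lt_0_compat; lra).
    assert (Hh : 0 < h <= 1 / 8) by (unfold h; split; [apply Rmin_case; lra | apply Rmin_l]).
    assert (Hh2 : 4 * h * B <= Rabs a / 2).
    { assert (Hh3 : h <= Rabs a / (8 * (B + 1))) by apply Rmin_r.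
      apply (Rmult_le_compat_r (8 * (B + 1))) in Hh3; [| lra].
      replace (Rabs a / (8 * (B + 1)) * (8 * (B + 1))) with (Rabs a) in Hh3
        by (field; lra).
      nra. }
    destruct (Hk h ltac:(lra)) as (T & x & y & Hp & HI).
    assert (Hd := oval_param_derive h T x y Hp).
    assert (HT : 0 < T) by (destruct Hp; lra).
    assert (Hpos := oval_moment_pos h T x y k ltac:(lra) Hp).
    assert (Hc1 : forall t, 0 <= t <= T ->
      continuous (fun t => (x t ^ 2) ^ k * y t ^ 2) t).
    { intros t Ht; destruct (Hd t Ht) as (Hx & Hy & _); continuous_along Hx Hy. }
    assert (Hc2 : forall t, 0 <= t <= T ->
      continuous (fun t => (x t ^ 2) ^ k * horner (a :: l) (x t ^ 2) * y t ^ 2) t).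
    { intros t Ht; destruct (Hd t Ht) as (Hx & Hy & _).
      apply (continuous_mult (K := R_AbsRing)); [apply (continuous_mult (K := R_AbsRing)) |].
      - continuous_along Hx Hy.
      - apply continuous_horner; continuous_along Hx Hy.
      - continuous_along Hx Hy. }
    assert (Hex : forall f : R -> R, (forall t, 0 <= t <= T -> continuous f t) ->
      ex_RInt f 0 T).
    { intros f Hf; apply (ex_RInt_continuous (V := R_CompleteNormedModule)).
      intros t; rewrite Rmin_left, Rmax_right by lra; auto. }
    (* Multiplying by [a] makes the argument independent of the sign of [a]. *)
    assert (Hle : RInt (fun t => scal (a ^ 2 / 2) ((x t ^ 2) ^ k * y t ^ 2)) 0 T
      <= RInt (fun t => scal a ((x t ^ 2) ^ k * horner (a :: l) (x t ^ 2) * y t ^ 2)) 0 T).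
    { apply RInt_le; [lra | | |].
      - apply (ex_RInt_scal (V := R_NormedModule)), Hex, Hc1.
      - apply (ex_RInt_scal (V := R_NormedModule)), Hex, Hc2.
      - intros t Ht; unfold scal; simpl; unfold mult; simpl.
        destruct Hp as (_ & _ & Ho & _).
        destruct (oval_bounds h (x t) (y t) ltac:(lra) (Ho t ltac:(lra))) as (_ & Hx2 & _).
        simpl in Hx2.
        set (s := x t * (x t * 1)) in *.
        assert (Hs : 0 <= s) by (unfold s; nra).
        assert (Hb := Hl s ltac:(lra)).
        replace (a * (s ^ k * (a + s * horner l s) * (y t * (y t * 1))))
          with ((a * (a + s * horner l s)) * (s ^ k * (y t * (y t * 1)))) by ring.
        apply Rmult_le_compat_r.
        { apply Rmult_le_pos; [apply pow_le, Hs | nra]. }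
        assert (Habs : Rabs (a * (s * horner l s)) <= Rabs a * (Rabs a / 2)).
        { rewrite Rabs_mult, Rabs_mult, (Rabs_pos_eq s) by exact Hs.
          apply Rmult_le_compat_l; [lra |].
          assert (P := Rabs_pos (horner l s)); nra. }
        assert (E2 : Rabs a * Rabs a = a * a) by (rewrite <- Rabs_mult; apply Rabs_pos_eq; nra).
        apply Rabs_le_between in Habs; nra. }
    rewrite (RInt_scal (V := R_CompleteNormedModule) _ _ _ (a ^ 2 / 2)) in Hle
      by apply Hex, Hc1.
    rewrite (RInt_scal (V := R_CompleteNormedModule) _ _ _ a) in Hle
      by apply Hex, Hc2.
    rewrite HI in Hle; unfold scal in Hle; simpl in Hle; unfold mult in Hle; simpl in Hle.
    assert (0 < a * (a * 1) / 2) by nra.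
    simpl in Hpos; nra. }
  constructor; [exact Ea |].
  apply (IH (S k)); intros h Hh.
  destruct (Hk h Hh) as (T & x & y & Hp & HI); exists T, x, y; split; [exact Hp |].
  etransitivity; [| exact HI].
  apply RInt_ext; intros t _; simpl; rewrite Ea; to_R; ring.
Qed.

Lemma melnikov_integral_zero (kappa : R) (g : nat -> R) :
  g 3%nat = 0 ->
  (forall h, 0 < h < 1 / 4 -> exists T x y, oval_param h T x y /\
     RInt (fun t => melnikov_integrand kappa g (x t) (y t)) 0 T = 0) ->
  kappa = 0 /\ forall j, (1 <= j <= 6)%nat -> g j = 0.
Proof.
  intros E3 Hint.
  assert (Hz := even_polynomial_zero [g 1%nat; g 2%nat; g 4%nat + 5 * g 5%nat;
      g 6%nat - 8 * g 5%nat - 6 / 5 * kappa; 3 * g 5%nat + 72 / 35 * kappa;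
      - (6 / 7) * kappa] 0).
  assert (Hall : List.Forall (fun a : R => a = 0) [g 1%nat; g 2%nat; g 4%nat + 5 * g 5%nat;
      g 6%nat - 8 * g 5%nat - 6 / 5 * kappa; 3 * g 5%nat + 72 / 35 * kappa;
      - (6 / 7) * kappa]).
  { apply Hz; intros h Hh; destruct (Hint h Hh) as (T & x & y & Hp & E).
    exists T, x, y; split; [exact Hp |].
    rewrite (melnikov_even_form h T x y kappa g Hp E3) in E.
    etransitivity; [| exact E].
    apply RInt_ext; intros t _; simpl; to_R; ring. }
  forall_inv.
  assert (Ek : kappa = 0) by lra; subst kappa.
  split; [reflexivity |]; intros j Hj.
  destruct j as [| [| [| [| [| [| [| j]]]]]]]; try lia; lra.
Qed.

(** * Continuous dependence of orbits *)

Lemma sqr_le_4 (x : R) : Rabs x <= 2 -> 0 <= x ^ 2 <= 4.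
Proof. intros Hx; apply Rabs_le_between in Hx; nra. Qed.

Lemma friction_bound (l : nat -> R) (e x y : R) :
  (forall j, (1 <= j <= 6)%nat -> Rabs (l j) <= e) ->
  Rabs x <= 2 -> Rabs y <= 2 -> Rabs (friction l x y) <= 105 * e.
Proof.
  intros Hl Hx Hy.
  assert (Hx2 := sqr_le_4 x Hx); assert (Hy2 := sqr_le_4 y Hy).
  assert (He : 0 <= e) by (eapply Rle_trans; [apply Rabs_pos | apply (Hl 1%nat); lia]).
  assert (Hm : forall j m M, (1 <= j <= 6)%nat -> 0 <= m <= M ->
            - (M * e) <= l j * m <= M * e).
  { intros j m M Hj Hm; specialize (Hl j Hj); apply Rabs_le_between in Hl; nra. }
  (* 105 = 1 + 4 + 4 + 16 + 16 + 64, the sum of the monomials at [x = y = 2]. *)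
  assert (H2 := Hm 2%nat (x ^ 2) 4 ltac:(lia) Hx2).
  assert (H3 := Hm 3%nat (y ^ 2) 4 ltac:(lia) Hy2).
  assert (H4 := Hm 4%nat (x ^ 4) 16 ltac:(lia)
    ltac:(replace (x ^ 4) with (x ^ 2 * x ^ 2) by ring; nra)).
  assert (H5 := Hm 5%nat (y ^ 4) 16 ltac:(lia)
    ltac:(replace (y ^ 4) with (y ^ 2 * y ^ 2) by ring; nra)).
  assert (H6 := Hm 6%nat (x ^ 6) 64 ltac:(lia)
    ltac:(replace (x ^ 6) with (x ^ 2 * (x ^ 2 * x ^ 2)) by ring;
          assert (0 <= x ^ 2 * x ^ 2 <= 16) by nra; nra)).
  assert (H1 := Hm 1%nat 1 1 ltac:(lia) ltac:(lra)).
  unfold friction; apply Rabs_le; lra.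
Qed.

(** Inside the box [|x|, |y| <= 2] the squared distance [E] of a perturbed to an unperturbed orbit
    satisfies [E' <= 8 E + (210 e) ^ 2]; the orbit cannot leave the box because [E] stays below
    1. *)
Lemma gronwall (l : nat -> R) (e T0 T mu : R) (u v x y : R -> R) :
  trajectory (fun _ => 0) T0 u v -> trajectory l T x y ->
  (forall t, 0 <= t <= T0 -> Rabs (u t) <= 1 /\ Rabs (v t) <= 1) ->
  (forall j, (1 <= j <= 6)%nat -> Rabs (l j) <= e) -> mu <= 1 ->
  ((x 0 - u 0) ^ 2 + (y 0 - v 0) ^ 2 + (210 * e) ^ 2) * exp (8 * T0) < mu ->
  forall t, 0 <= t <= T -> t <= T0 -> (x t - u t) ^ 2 + (y t - v t) ^ 2 < mu.
Proof.
  intros Hu Hx Hbox Hl Hmu Hsmall.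
  rewrite trajectory_derive_0 in Hu; rewrite trajectory_derive in Hx.
  assert (He : 0 <= e) by (eapply Rle_trans; [apply Rabs_pos | apply (Hl 1%nat); lia]).
  set (E := fun t => (x t - u t) ^ 2 + (y t - v t) ^ 2).
  set (K := (210 * e) ^ 2) in *.
  change ((E 0 + K) * exp (8 * T0) < mu) in Hsmall.
  set (dE := fun t => 2 * (x t - u t) * (y t - v t) + 2 * (y t - v t) *
    (- x t + x t ^ 3 + friction l (x t) (y t) * y t - (- u t + u t ^ 3))).
  assert (HE : forall t, 0 <= t <= T -> t <= T0 -> is_derive E t (dE t)).
  { intros t Ht Ht0; destruct (Hx t Ht) as [X Y]; destruct (Hu t ltac:(lra)) as [U V].
    unfold E; auto_derive.
    - repeat split; eexists; eassumption.
    - subst_derive X; subst_derive Y; subst_derive U; subst_derive V; unfold dE; ring. }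
  assert (HdE : forall t, 0 <= t <= T -> t <= T0 -> E t <= 1 -> dE t <= 8 * E t + K).
  { intros t Ht Ht0 H1; destruct (Hbox t ltac:(lra)) as [U V].
    apply Rabs_le_between in U; apply Rabs_le_between in V; unfold E in H1.
    assert (Pz := pow2_ge_0 (x t - u t)); assert (Pw := pow2_ge_0 (y t - v t)).
    assert (Bz : - 1 <= x t - u t <= 1) by (split; nra).
    assert (Bw : - 1 <= y t - v t <= 1) by (split; nra).
    assert (Bx : Rabs (x t) <= 2) by (apply Rabs_le; lra).
    assert (By : Rabs (y t) <= 2) by (apply Rabs_le; lra).
    assert (Bf := friction_bound l e (x t) (y t) Hl Bx By).
    apply Rabs_le_between in Bx; apply Rabs_le_between in By.
    assert (Bfy : Rabs (friction l (x t) (y t) * y t) <= 210 * e).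
    { rewrite Rabs_mult; replace (210 * e) with (105 * e * 2) by ring.
      apply Rmult_le_compat; try apply Rabs_pos; [exact Bf | apply Rabs_le; lra]. }
    apply Rabs_le_between in Bfy.
    unfold dE, E, K; clearbody E dE K; clear HE.
    set (F := friction l (x t) (y t) * y t) in *.
    set (z := x t - u t) in *; set (w := y t - v t) in *.
    set (q := x t ^ 2 + x t * u t + u t ^ 2).
    assert (Hq : 0 <= q <= 7) by (unfold q; nra).
    replace (- x t + x t ^ 3 + F - (- u t + u t ^ 3)) with (- z + z * q + F)
      by (unfold z, q; ring).
    assert (P1 : 2 * w * z * q <= 7 * (z ^ 2 + w ^ 2)).
    { assert (2 * w * z <= z ^ 2 + w ^ 2) by (assert (0 <= (z - w) ^ 2) by apply pow2_ge_0; nra).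
      assert (0 <= z ^ 2 + w ^ 2) by nra. nra. }
    assert (P2 : 2 * w * F <= w ^ 2 + (210 * e) ^ 2).
    { assert (0 <= (w - F) ^ 2) by apply pow2_ge_0.
      assert (F ^ 2 <= (210 * e) ^ 2) by nra. nra. }
    assert (0 <= z ^ 2) by apply pow2_ge_0. nra. }
  assert (Hdec : forall m, 0 <= m <= T -> m <= T0 -> (forall s, 0 <= s <= m -> E s <= 1) ->
            E m < mu).
  { intros m Hm Hm0 Hs.
    (* On [0, m] the derivative of [(E + K) exp (- 8 t)] is at most [- 7 K exp (- 8 t)]. *)
    assert (D : (E m + K) * exp (- 8 * m) <= (E 0 + K) * exp (- 8 * 0)).
    { apply (derive_nonpos (fun t => (E t + K) * exp (- 8 * t))
        (fun t => (dE t - 8 * (E t + K)) * exp (- 8 * t))); [lra | |].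
      - intros t Ht; assert (X := HE t ltac:(lra) ltac:(lra)).
        auto_derive; [repeat split; eexists; exact X |]; subst_derive X; ring.
      - intros t Ht.
        assert (X := HdE t ltac:(lra) ltac:(lra) (Hs t Ht)).
        assert (P := exp_pos (- 8 * t)).
        assert (0 <= K) by apply pow2_ge_0. nra. }
    rewrite Rmult_0_r, exp_0, Rmult_1_r in D.
    assert (Eexp : exp (- 8 * m) * exp (8 * m) = 1)
      by (rewrite <- exp_plus; replace (- 8 * m + 8 * m) with 0 by ring; apply exp_0).
    assert (Hexp : exp (8 * m) <= exp (8 * T0)).
    { destruct (Req_dec m T0) as [-> | N]; [lra | left; apply exp_increasing; lra]. }
    assert (P := exp_pos (8 * m)).
    assert (0 <= K) by apply pow2_ge_0.
    assert (0 <= E 0) by (unfold E; apply Rplus_le_le_0_compat; apply pow2_ge_0).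
    assert (D2 : E m + K <= (E 0 + K) * exp (8 * m)).
    { apply (Rmult_le_compat_r (exp (8 * m))) in D; [| lra].
      rewrite Rmult_assoc, Eexp in D; lra. }
    assert ((E 0 + K) * exp (8 * m) <= (E 0 + K) * exp (8 * T0))
      by (apply Rmult_le_compat_l; lra).
    lra. }
  intros t Ht Ht0; change (E t < mu).
  apply Hdec; [exact Ht | exact Ht0 |].
  intros s Hs; destruct (Rle_lt_dec (E s) 1) as [Hl1 | Hl1]; [exact Hl1 | exfalso].
  assert (Hstart : E 0 < 1).
  { assert (P := exp_ineq1_le (8 * T0)); assert (0 <= K) by apply pow2_ge_0.
    assert (0 <= E 0) by (unfold E; apply Rplus_le_le_0_compat; apply pow2_ge_0).
    nra. }
  destruct (first_exit E s) as (m & Hm & Hm1 & Hms); try lra.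
  - intros r Hr; apply (ex_derive_continuous (K := R_AbsRing) (V := R_NormedModule)).
    eexists; apply HE; lra.
  - assert (E m < mu) by (apply Hdec; auto; lra). lra.
Qed.

Lemma close_orbits (T0 eta : R) (u v : R -> R) :
  trajectory (fun _ => 0) T0 u v ->
  (forall t, 0 <= t <= T0 -> Rabs (u t) <= 1 /\ Rabs (v t) <= 1) -> 0 < eta ->
  exists rho, 0 < rho /\ forall l T x y,
    (forall j, (1 <= j <= 6)%nat -> Rabs (l j) <= rho) ->
    trajectory l T x y -> Rabs (x 0 - u 0) <= rho -> Rabs (y 0 - v 0) <= rho ->
    forall t, 0 <= t <= T -> t <= T0 ->
    Rabs (x t - u t) < eta /\ Rabs (y t - v t) < eta.
Proof.
  intros Hu Hbox Heta.
  destruct (small2 1 (eta ^ 2)) as (mu & Hmu & Hmu1 & Hmu2); [lra | nra |].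
  assert (P := exp_pos (8 * T0)).
  destruct (small2 1 (mu / (44103 * exp (8 * T0)))) as (rho & Hr & Hr1 & Hr2);
    [lra | apply Rdiv_lt_0_compat; lra |].
  exists rho; split; [exact Hr |].
  intros l T x y Hl Hx Hx0 Hy0 t Ht Ht0.
  assert (Hlt : (x t - u t) ^ 2 + (y t - v t) ^ 2 < mu).
  { apply (gronwall l rho T0 T mu u v x y); auto.
    apply Rle_lt_trans with (44102 * rho * exp (8 * T0)).
    - apply Rmult_le_compat_r; [lra |].
      apply Rabs_le_between in Hx0; apply Rabs_le_between in Hy0; nra.
    - apply (Rmult_le_compat_r (44103 * exp (8 * T0))) in Hr2; [| lra].
      replace (mu / (44103 * exp (8 * T0)) * (44103 * exp (8 * T0))) with mu in Hr2
        by (field; lra).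
      assert (0 < rho * exp (8 * T0)) by (apply Rmult_lt_0_compat; lra). lra. }
  assert (P1 := pow2_ge_0 (x t - u t)); assert (P2 := pow2_ge_0 (y t - v t)).
  split; apply Rabs_def1; nra.
Qed.

Lemma unique_orbit (T0 T : R) (u v x y : R -> R) :
  trajectory (fun _ => 0) T0 u v ->
  (forall t, 0 <= t <= T0 -> Rabs (u t) <= 1 /\ Rabs (v t) <= 1) ->
  trajectory (fun _ => 0) T x y -> x 0 = u 0 -> y 0 = v 0 ->
  forall t, 0 <= t <= T -> t <= T0 -> x t = u t /\ y t = v t.
Proof.
  intros Hu Hbox Hx Ex Ey t Ht Ht0.
  assert (Hc : forall eta, 0 < eta -> Rabs (x t - u t) < eta /\ Rabs (y t - v t) < eta).
  { intros eta Heta.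
    destruct (close_orbits T0 eta u v Hu Hbox Heta) as (rho & Hr & Hcl).
    apply (Hcl (fun _ => 0) T); auto.
    - intros; rewrite Rabs_R0; lra.
    - rewrite Ex, Rminus_diag, Rabs_R0; lra.
    - rewrite Ey, Rminus_diag, Rabs_R0; lra. }
  split; apply Rminus_diag_uniq.
  - destruct (Req_dec (x t - u t) 0) as [E | N]; [exact E |].
    destruct (Hc _ (Rabs_pos_lt _ N)); lra.
  - destruct (Req_dec (y t - v t) 0) as [E | N]; [exact E |].
    destruct (Hc _ (Rabs_pos_lt _ N)); lra.
Qed.

(** * Independence of the parametrization of an oval *)

(** The closed curve started at the point reached at time [s].  Gluing two pieces avoids the
    periodic extension of the orbit beyond [0, T]. *)
Definition rotate (T s : R) (x : R -> R) (t : R) : R :=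
  if Rle_dec t (T - s) then x (t + s) else x (t + (s - T)).

Lemma rotate_derive (T s : R) (x dx : R -> R) :
  0 < s < T -> x T = x 0 -> dx T = dx 0 ->
  (forall t, 0 <= t <= T -> is_derive x t (dx t)) ->
  forall t, 0 <= t <= T -> is_derive (rotate T s x) t (rotate T s dx t).
Proof.
  intros Hs Ex Edx Hx t Ht; unfold rotate at 2.
  destruct (Rlt_le_dec t (T - s)) as [L1 | L1].
  - destruct (Rle_dec t (T - s)) as [_ | N]; [| lra].
    apply (is_derive_ext_loc (fun r => x (r + s))).
    + exists (mkposreal (T - s - t) ltac:(lra)); intros r Hr.
      apply Rabs_lt_between in Hr; simpl in Hr; unfold minus, plus, opp in Hr; simpl in Hr.
      unfold rotate; destruct (Rle_dec r (T - s)); [reflexivity | lra].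
    + apply is_derive_shift, Hx; lra.
  - destruct (Req_dec t (T - s)) as [-> | N].
    + destruct (Rle_dec (T - s) (T - s)) as [_ | N]; [| lra].
      apply (is_derive_glue (fun r => x (r + s)) (fun r => x (r + (s - T)))).
      * replace (T - s + s) with T by ring; replace (T - s + (s - T)) with 0 by ring; exact Ex.
      * apply is_derive_shift, Hx; lra.
      * apply is_derive_shift.
        replace (T - s + s) with T by ring; replace (T - s + (s - T)) with 0 by ring.
        rewrite Edx; apply Hx; lra.
    + destruct (Rle_dec t (T - s)) as [N' | _]; [lra |].
      apply (is_derive_ext_loc (fun r => x (r + (s - T)))).
      * exists (mkposreal (t - (T - s)) ltac:(lra)); intros r Hr.
        apply Rabs_lt_between in Hr; simpl in Hr; unfold minus, plus, opp in Hr; simpl in Hr.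
        unfold rotate; destruct (Rle_dec r (T - s)); [lra | reflexivity].
      * apply is_derive_shift, Hx; lra.
Qed.

(** If the orbit met itself at times [r < s], following both branches until time [T] would bring
    it back to its starting point at the time [T - s + r], before [T]. *)
Lemma orbit_injective (h T r s : R) (x y : R -> R) :
  h < 1 / 4 -> oval_param h T x y -> 0 <= r -> r < s -> s <= T -> s < T \/ 0 < r ->
  ~ (x r = x s /\ y r = y s).
Proof.
  intros Hh Hp Hr Hrs Hs Hint [Ex Ey].
  assert (Hbox := oval_param_box h T x y Hh Hp).
  destruct Hp as (HT & Htr & Ho & ExT & EyT & Hmin).
  assert (Hun := unique_orbit (T - s) (T - r) (fun t => x (t + s)) (fun t => y (t + s))
    (fun t => x (t + r)) (fun t => y (t + r))
    (trajectory_shift _ T s x y ltac:(lra) Htr)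
    ltac:(intros; apply Hbox; lra)
    (trajectory_shift _ T r x y ltac:(lra) Htr)).
  simpl in Hun; rewrite !Rplus_0_l in Hun.
  destruct (Hun Ex Ey (T - s) ltac:(lra) ltac:(lra)) as [E1 E2].
  replace (T - s + s) with T in E1, E2 by ring.
  apply (Hmin (T - s + r)); [lra |].
  rewrite E1, E2; auto.
Qed.

Lemma oval_param_rotate (h T s : R) (x y : R -> R) :
  h < 1 / 4 -> oval_param h T x y -> 0 < s < T ->
  oval_param h T (rotate T s x) (rotate T s y).
Proof.
  intros Hh Hp Hs; assert (Hinj := fun r => orbit_injective h T r s x y Hh Hp).
  assert (Hinj2 := fun r => orbit_injective h T s r x y Hh Hp).
  destruct Hp as (HT & Htr & Ho & ExT & EyT & Hmin).
  assert (E0 : forall f, rotate T s f 0 = f s).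
  { intros f; unfold rotate; destruct (Rle_dec 0 (T - s)); [f_equal; ring | lra]. }
  assert (E1 : forall f, rotate T s f T = f s).
  { intros f; unfold rotate; destruct (Rle_dec T (T - s)); [lra | f_equal; ring]. }
  split; [exact HT |]; split; [| split; [| split; [| split]]].
  - rewrite trajectory_derive_0 in *; intros t Ht; split.
    + apply (rotate_derive T s x y); auto; intros; apply Htr; lra.
    + replace (- rotate T s x t + rotate T s x t ^ 3)
        with (rotate T s (fun r => - x r + x r ^ 3) t)
        by (unfold rotate; destruct (Rle_dec t (T - s)); reflexivity).
      apply rotate_derive; auto; [rewrite ExT; reflexivity |].
      intros; apply Htr; lra.
  - intros t Ht; unfold rotate; destruct (Rle_dec t (T - s)); apply Ho; lra.
  - rewrite E0, E1; reflexivity.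
  - rewrite E0, E1; reflexivity.
  - intros t Ht; rewrite !E0; unfold rotate; destruct (Rle_dec t (T - s)).
    + intros [A B]; apply (Hinj2 (t + s)); try lra; split; congruence.
    + apply Hinj; lra.
Qed.

Lemma RInt_rotate (T s : R) (f : R -> R) :
  0 < s < T -> (forall t, 0 <= t <= T -> continuous f t) ->
  RInt (rotate T s f) 0 T = RInt f 0 T.
Proof.
  intros Hs Hc.
  assert (Hex : forall a b, 0 <= a -> a <= b -> b <= T -> is_RInt f a b (RInt f a b)).
  { intros a b Ha Hab Hb; apply (RInt_correct (V := R_CompleteNormedModule)).
    apply (ex_RInt_continuous (V := R_CompleteNormedModule)).
    intros r; rewrite Rmin_left, Rmax_right by lra; intros; apply Hc; lra. }
  assert (Hsh : forall a b c I, is_RInt f (a + c) (b + c) I ->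
            is_RInt (fun t => f (t + c)) a b I).
  { intros a b c I HI.
    apply (is_RInt_ext (fun t => scal 1 (f (1 * t + c)))).
    - intros t _; unfold scal; simpl; unfold mult; simpl; rewrite !Rmult_1_l; reflexivity.
    - apply (is_RInt_comp_lin (V := R_NormedModule) f 1 c a b); rewrite !Rmult_1_l; exact HI. }
  assert (E : RInt f 0 T = RInt f s T + RInt f 0 s).
  { rewrite Rplus_comm; symmetry.
    apply (RInt_Chasles (V := R_CompleteNormedModule)); eexists; apply Hex; lra. }
  rewrite E; apply (is_RInt_unique (V := R_CompleteNormedModule)).
  apply (is_RInt_Chasles (V := R_NormedModule) _ 0 (T - s) T).
  - apply (is_RInt_ext (fun t => f (t + s))).
    + intros t Ht; rewrite Rmin_left, Rmax_right in Ht by lra.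
      unfold rotate; destruct (Rle_dec t (T - s)); [reflexivity | lra].
    + apply Hsh; rewrite Rplus_0_l; replace (T - s + s) with T by ring; apply Hex; lra.
  - apply (is_RInt_ext (fun t => f (t + (s - T)))).
    + intros t Ht; rewrite Rmin_left, Rmax_right in Ht by lra.
      unfold rotate; destruct (Rle_dec t (T - s)); [lra | reflexivity].
    + apply Hsh; replace (T - s + (s - T)) with 0 by ring;
        replace (T + (s - T)) with s by ring; apply Hex; lra.
Qed.

Lemma oval_param_opp (h T : R) (x y : R -> R) :
  oval_param h T x y -> oval_param h T (fun t => - x t) (fun t => - y t).
Proof.
  intros (HT & Htr & Ho & ExT & EyT & Hmin).
  split; [exact HT |]; split; [| split; [| split; [| split]]]; try congruence.
  - rewrite trajectory_derive_0 in *; intros t Ht; destruct (Htr t Ht) as [Hx Hy]; split.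
    + exact (is_derive_opp (V := R_NormedModule) _ _ _ Hx).
    + replace (- - x t + (- x t) ^ 3) with (opp (- x t + x t ^ 3))
        by (unfold opp; simpl; ring).
      exact (is_derive_opp (V := R_NormedModule) _ _ _ Hy).
  - intros t Ht; destruct (Ho t Ht) as [E B]; split; [| lra].
    rewrite <- E; unfold H; field.
  - intros t Ht [A B]; apply (Hmin t Ht); lra.
Qed.

(** By Rolle's theorem the orbit crosses the axis [y = 0].  Starting there, and using the symmetry
    [(x, y) -> (- x, - y)] if the crossing is at the left end, all parametrizations of the same
    oval start at the same point. *)
Lemma oval_param_normalize (h T : R) (x y : R -> R) :
  0 < h < 1 / 4 -> oval_param h T x y ->
  exists z w, oval_param h T z w /\ w 0 = 0 /\ 0 < z 0 /\
    forall k, RInt (fun t => (z t ^ 2) ^ k * w t ^ 2) 0 T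
      = RInt (fun t => (x t ^ 2) ^ k * y t ^ 2) 0 T.
Proof.
  intros Hh Hp; assert (Hd := oval_param_derive h T x y Hp).
  assert (HT : 0 < T) by (destruct Hp; lra).
  assert (Hs : exists s, 0 < s < T /\ y s = 0).
  { destruct Hp as (_ & _ & _ & ExT & _).
    destruct (MVT_cor2 x y 0 T HT) as (s & E & Hs).
    { intros t Ht; apply is_derive_Reals, Hd, Ht. }
    exists s; split; [lra |]; rewrite ExT in E.
    assert (P : y s * (T - 0) = 0) by lra.
    apply Rmult_integral in P; lra. }
  destruct Hs as (s & Hs & Es).
  assert (Hrot := oval_param_rotate h T s x y ltac:(lra) Hp Hs).
  assert (E0 : forall f, rotate T s f 0 = f s).
  { intros f; unfold rotate; destruct (Rle_dec 0 (T - s)); [f_equal; ring | lra]. }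
  assert (HI : forall k,
    RInt (fun t => (rotate T s x t ^ 2) ^ k * rotate T s y t ^ 2) 0 T
      = RInt (fun t => (x t ^ 2) ^ k * y t ^ 2) 0 T).
  { intros k; rewrite <- (RInt_rotate T s (fun t => (x t ^ 2) ^ k * y t ^ 2) Hs).
    - apply RInt_ext; intros t _; unfold rotate; destruct (Rle_dec t (T - s)); reflexivity.
    - intros t Ht; destruct (Hd t Ht) as (Hx & Hy & _); continuous_along Hx Hy. }
  assert (Hx0 : x s <> 0).
  { intros Ex; destruct (Hd s ltac:(lra)) as (_ & _ & E).
    rewrite Ex, Es in E; unfold H in E; lra. }
  destruct (Rlt_le_dec 0 (x s)) as [Hpos | Hneg].
  - exists (rotate T s x), (rotate T s y); rewrite !E0; auto.
  - exists (fun t => - rotate T s x t), (fun t => - rotate T s y t).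
    split; [apply oval_param_opp, Hrot |]; rewrite !E0.
    split; [lra |]; split; [lra |].
    intros k; rewrite <- HI; apply RInt_ext; intros t _.
    replace ((- rotate T s x t) ^ 2) with (rotate T s x t ^ 2) by ring.
    replace ((- rotate T s y t) ^ 2) with (rotate T s y t ^ 2) by ring. reflexivity.
Qed.

Lemma oval_integral_unique (h T1 T2 : R) (x1 y1 x2 y2 : R -> R) (k : nat) :
  0 < h < 1 / 4 -> oval_param h T1 x1 y1 -> oval_param h T2 x2 y2 ->
  RInt (fun t => (x1 t ^ 2) ^ k * y1 t ^ 2) 0 T1
  = RInt (fun t => (x2 t ^ 2) ^ k * y2 t ^ 2) 0 T2.
Proof.
  intros Hh Hp1 Hp2.
  destruct (oval_param_normalize h T1 x1 y1 Hh Hp1) as (z1 & w1 & Hq1 & Ew1 & Hz1 & <-).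
  destruct (oval_param_normalize h T2 x2 y2 Hh Hp2) as (z2 & w2 & Hq2 & Ew2 & Hz2 & <-).
  assert (Ez : z1 0 = z2 0).
  { destruct Hq1 as (HT1 & _ & Ho1 & _); destruct Hq2 as (HT2 & _ & Ho2 & _).
    destruct (Ho1 0 ltac:(lra)) as [E1 B1]; destruct (Ho2 0 ltac:(lra)) as [E2 B2].
    unfold H in E1, E2; rewrite Ew1 in E1; rewrite Ew2 in E2.
    set (a := z1 0) in *; set (b := z2 0) in *.
    assert (E : (a - b) * ((a + b) * (1 / 2 - (a ^ 2 + b ^ 2) / 4)) = 0) by lra.
    assert (a ^ 2 < 1 /\ b ^ 2 < 1) by (split; nra).
    assert (0 < (a + b) * (1 / 2 - (a ^ 2 + b ^ 2) / 4)) by (apply Rmult_lt_0_compat; lra).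
    apply Rmult_integral in E; lra. }
  assert (Hb1 := oval_param_box h T1 z1 w1 ltac:(lra) Hq1).
  assert (Hb2 := oval_param_box h T2 z2 w2 ltac:(lra) Hq2).
  destruct Hq1 as (HT1 & Htr1 & Ho1 & Ex1 & Ey1 & Hm1).
  destruct Hq2 as (HT2 & Htr2 & Ho2 & Ex2 & Ey2 & Hm2).
  assert (Hun := unique_orbit T2 T1 z2 w2 z1 w1 Htr2 Hb2 Htr1 Ez ltac:(congruence)).
  assert (ET : T1 = T2).
  { destruct (Rtotal_order T1 T2) as [L1 | [E | L1]]; [exfalso | exact E | exfalso].
    - destruct (Hun T1 ltac:(lra) ltac:(lra)) as [A B].
      apply (Hm2 T1 ltac:(lra)); split; congruence.
    - destruct (Hun T2 ltac:(lra) ltac:(lra)) as [A B].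
      apply (Hm1 T2 ltac:(lra)); split; congruence. }
  subst T2; apply RInt_ext; intros t Ht; rewrite Rmin_left, Rmax_right in Ht by lra.
  destruct (Hun t ltac:(lra) ltac:(lra)) as [-> ->]; reflexivity.
Qed.

(** * The return to the section *)

Definition return_orbit (sx sy : R -> R) (l : nat -> R) (h p T : R) (x y : R -> R) :=
  0 < T /\ trajectory l T x y /\
  x 0 = sx h /\ y 0 = sy h /\
  0 < p < 1 / 4 /\ x T = sx p /\ y T = sy p /\
  (forall t q, 0 < t < T -> 0 < q < 1 / 4 -> ~ (x t = sx q /\ y t = sy q)).

Lemma H_lipschitz (x y u v r : R) :
  Rabs x <= 2 -> Rabs y <= 2 -> Rabs u <= 2 -> Rabs v <= 2 ->
  Rabs (x - u) <= r -> Rabs (y - v) <= r -> Rabs (H x y - H u v) <= 24 * r.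
Proof.
  intros Hx Hy Hu Hv Hr1 Hr2.
  replace (H x y - H u v) with ((y - v) * ((y + v) / 2)
    + (x - u) * ((x + u) * (1 / 2 - (x ^ 2 + u ^ 2) / 4))) by (unfold H; field).
  eapply Rle_trans; [apply Rabs_triang |]; rewrite !Rabs_mult.
  assert (P1 : Rabs ((y + v) / 2) <= 2) by (rabs; apply Rabs_le; lra).
  assert (P2 : Rabs (x + u) <= 4) by (rabs; apply Rabs_le; lra).
  assert (Hx2 := sqr_le_4 x Hx); assert (Hu2 := sqr_le_4 u Hu).
  assert (P3 : Rabs (1 / 2 - (x ^ 2 + u ^ 2) / 4) <= 2) by (apply Rabs_le; lra).
  assert (Q1 := Rabs_pos (y - v)); assert (Q2 := Rabs_pos (x - u)).
  assert (Q3 := Rabs_pos (x + u)); assert (Q4 := Rabs_pos (1 / 2 - (x ^ 2 + u ^ 2) / 4)).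
  assert (Rabs (y - v) * Rabs ((y + v) / 2) <= r * 2)
    by (apply Rmult_le_compat; auto using Rabs_pos).
  assert (Rabs (x + u) * Rabs (1 / 2 - (x ^ 2 + u ^ 2) / 4) <= 4 * 2)
    by (apply Rmult_le_compat; auto).
  assert (Rabs (x - u) * (Rabs (x + u) * Rabs (1 / 2 - (x ^ 2 + u ^ 2) / 4)) <= r * (4 * 2))
    by (apply Rmult_le_compat; auto; apply Rmult_le_pos; auto).
  lra.
Qed.

(** A chord of a level curve of [H] is nearly parallel to the nearby vector field of [X_0], hence
    it cannot be orthogonal to the vector field [(y0, - x0 + x0 ^ 3)] at [(x0, y0)].  On the
    square of half-width [r] the two directions differ by at most [8 r] in each coordinate,
    which the factor 20 outweighs. *)
Lemma transversal_unique (x0 y0 r x y x' y' : R) :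
  -1 < x0 < 1 -> -1 < y0 < 1 ->
  20 * r <= y0 ^ 2 + (- x0 + x0 ^ 3) ^ 2 ->
  Rabs (x - x0) < r -> Rabs (y - y0) < r -> Rabs (x' - x0) < r -> Rabs (y' - y0) < r ->
  H x y = H x' y' ->
  y0 * (x - x') + (- x0 + x0 ^ 3) * (y - y') = 0 -> x = x' /\ y = y'.
Proof.
  intros Hx0 Hy0 Hr Hx Hy Hx' Hy' HE Hperp.
  set (b := - x0 + x0 ^ 3) in *.
  assert (Hb : - 1 <= b <= 1) by (apply cubic_bound, Hx0).
  rabs.
  assert (Hr1 : r <= 1 / 10) by nra.
  (* [(A, B)] is the mean gradient of [H] over the chord; it is close to [(- b, y0)], the
     gradient at [(x0, y0)]. *)
  set (A := (x + x') * (1 / 2 - (x ^ 2 + x' ^ 2) / 4)).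
  assert (HA : - (8 * r) <= A + b <= 8 * r).
  { set (p := x - x0) in *; set (q := x' - x0) in *.
    assert (x0sq : 0 <= x0 ^ 2 <= 1) by nra.
    assert (Hp2 : 0 <= p ^ 2 <= r) by nra.
    assert (Hq2 : 0 <= q ^ 2 <= r) by nra.
    set (m := 2 * x0 * (p + q) + p ^ 2 + q ^ 2).
    assert (Hm : - (6 * r) <= m <= 6 * r) by (unfold m; split; nra).
    replace (A + b) with ((p + q) / 2 - (2 * x0 * m + (p + q) * (2 * x0 ^ 2 + m)) / 4)
      by (unfold A, b, m, p, q; field).
    assert (- (6 * r) <= x0 * m <= 6 * r) by (split; nra).
    assert (- (2 * r * 3) <= (p + q) * (2 * x0 ^ 2 + m) <= 2 * r * 3) by (split; nra).
    lra. }
  set (B := (y + y') / 2).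
  assert (HB : - r <= B - y0 <= r) by (unfold B; lra).
  assert (HD : 0 < y0 * B - b * A).
  { replace (y0 * B - b * A) with (y0 ^ 2 + b ^ 2 + y0 * (B - y0) - b * (A + b)) by ring.
    assert (- r <= y0 * (B - y0)) by nra.
    assert (b * (A + b) <= 8 * r) by nra. lra. }
  assert (HH : (y - y') * B + (x - x') * A = 0).
  { unfold A, B; unfold H in HE; lra. }
  assert (E1 : (y0 * B - b * A) * (y - y') = 0).
  { replace ((y0 * B - b * A) * (y - y')) with
      (y0 * ((y - y') * B + (x - x') * A) - A * (y0 * (x - x') + b * (y - y'))) by ring.
    rewrite HH, Hperp; ring. }
  assert (E2 : (y0 * B - b * A) * (x - x') = 0).
  { replace ((y0 * B - b * A) * (x - x')) with
      (B * (y0 * (x - x') + b * (y - y')) - b * ((y - y') * B + (x - x') * A)) by ring.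
    rewrite HH, Hperp; ring. }
  apply Rmult_integral in E1; apply Rmult_integral in E2; lra.
Qed.

Lemma transversal_speed (x0 y0 r x y : R) :
  -1 < x0 < 1 -> -1 < y0 < 1 ->
  20 * r <= y0 ^ 2 + (- x0 + x0 ^ 3) ^ 2 ->
  Rabs (x - x0) < r -> Rabs (y - y0) < r ->
  (y0 ^ 2 + (- x0 + x0 ^ 3) ^ 2) / 2 <= y0 * y + (- x0 + x0 ^ 3) * (- x + x ^ 3).
Proof.
  intros Hx0 Hy0 Hr Hx Hy.
  set (b := - x0 + x0 ^ 3) in *.
  assert (Hb : - 1 <= b <= 1) by (apply cubic_bound, Hx0).
  rabs.
  assert (Hr1 : r <= 1 / 10) by nra.
  set (p := x - x0) in *.
  set (q := 3 * x0 ^ 2 + 3 * x0 * p + p ^ 2 - 1).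
  assert (Hq : - 8 <= q <= 8).
  { assert (0 <= x0 ^ 2 <= 1) by nra. assert (0 <= p ^ 2 <= 1) by nra.
    assert (- 1 <= x0 * p <= 1) by (split; nra). unfold q; lra. }
  replace (- x + x ^ 3) with (b + p * q) by (unfold b, q, p; ring).
  assert (- (8 * r) <= p * q <= 8 * r) by (split; nra).
  assert (- r <= y0 * (y - y0)) by nra.
  assert (- (8 * r) <= b * (p * q)) by nra. nra.
Qed.

(** The chord from the point of the section on the level curve of [(x, y)] to [(x, y)], measured
    in the direction [(a, b)]. *)
Definition section_gap (sx sy : R -> R) (a b x y : R) : R :=
  a * (x - sx (H x y)) + b * (y - sy (H x y)).

(** At a zero of the gap the point is joined to the section by a chord of its level curve that is
    orthogonal to the vector field, so by [transversal_unique] it lies on the section. *)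
Lemma section_crossing (sx sy : R -> R) (h a b r : R) (x y : R -> R) :
  cross_section sx sy -> 0 < h < 1 / 4 ->
  20 * r <= sy h ^ 2 + (- sx h + sx h ^ 3) ^ 2 -> a < b ->
  (forall t, a <= t <= b -> ex_derive x t /\ ex_derive y t) ->
  (forall t, a <= t <= b -> Rabs (x t - sx h) < r /\ Rabs (y t - sy h) < r /\
     0 < H (x t) (y t) < 1 / 4 /\ Rabs (sx (H (x t) (y t)) - sx h) < r /\
     Rabs (sy (H (x t) (y t)) - sy h) < r) ->
  section_gap sx sy (sy h) (- sx h + sx h ^ 3) (x a) (y a) < 0 ->
  0 < section_gap sx sy (sy h) (- sx h + sx h ^ 3) (x b) (y b) ->
  exists t q, a <= t <= b /\ 0 < q < 1 / 4 /\ x t = sx q /\ y t = sy q.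
Proof.
  intros Hsec Hh Hr Hab Hc Hin Ha Hb.
  destruct (Hsec h Hh) as (Ho & _ & _).
  destruct (oval_bounds h _ _ ltac:(lra) Ho) as (Hy0 & _); destruct Ho as [_ Hx0].
  destruct (IVT_interv
    (fun t => section_gap sx sy (sy h) (- sx h + sx h ^ 3) (x t) (y t)) a b) as (t & Ht & E);
    [| exact Hab | exact Ha | exact Hb |].
  - intros t Ht; destruct (Hc t Ht) as [Cx Cy]; destruct (Hin t Ht) as (_ & _ & Hq & _).
    apply continuity_pt_filterlim; unfold section_gap.
    assert (CH : continuous (fun t => H (x t) (y t)) t).
    { apply (ex_derive_continuous (K := R_AbsRing) (V := R_NormedModule)).
      unfold H; auto_derive; repeat split; assumption. }
    assert (Cx' : continuous x t) by (apply (ex_derive_continuous (V := R_NormedModule)), Cx).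
    assert (Cy' : continuous y t) by (apply (ex_derive_continuous (V := R_NormedModule)), Cy).
    destruct (Hsec _ Hq) as (_ & Ax & Ay).
    assert (Csx : continuous (fun t => sx (H (x t) (y t))) t).
    { apply (continuous_comp (fun t => H (x t) (y t)) sx); [exact CH |].
      apply (ex_derive_continuous (K := R_AbsRing) (V := R_NormedModule)),
        analytic_ex_derive, Ax. }
    assert (Csy : continuous (fun t => sy (H (x t) (y t))) t).
    { apply (continuous_comp (fun t => H (x t) (y t)) sy); [exact CH |].
      apply (ex_derive_continuous (K := R_AbsRing) (V := R_NormedModule)),
        analytic_ex_derive, Ay. }
    apply (continuous_plus (V := R_NormedModule)
      (fun t => sy h * (x t - sx (H (x t) (y t))))
      (fun t => (- sx h + sx h ^ 3) * (y t - sy (H (x t) (y t))))).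
    + apply (continuous_scal_r (K := R_AbsRing) (V := R_NormedModule) (sy h)
        (fun t => x t - sx (H (x t) (y t)))).
      apply (continuous_minus (V := R_NormedModule)); assumption.
    + apply (continuous_scal_r (K := R_AbsRing) (V := R_NormedModule) (- sx h + sx h ^ 3)
        (fun t => y t - sy (H (x t) (y t)))).
      apply (continuous_minus (V := R_NormedModule)); assumption.
  - destruct (Hin t Ht) as (Hx & Hy & Hq & Hsx & Hsy).
    exists t, (H (x t) (y t)); split; [exact Ht |]; split; [exact Hq |].
    destruct (Hsec _ Hq) as ((Hq2 & _) & _).
    apply (transversal_unique (sx h) (sy h) r); auto.
Qed.

(** An orbit cannot return soon after its start: in time [T] it advances by a multiple of [T]
    along the vector field, whereas the energy, and hence the point of the section at that
    energy, moves by at most a multiple of [e T]. *)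
Lemma short_return (sx sy : R -> R) (h p T e K d r : R) (l : nat -> R) (x y : R -> R) :
  0 < h < 1 / 4 -> cross_section sx sy -> return_orbit sx sy l h p T x y ->
  0 <= K ->
  (forall q, Rabs (q - h) < d ->
     Rabs (sx q - sx h) <= K * Rabs (q - h) /\ Rabs (sy q - sy h) <= K * Rabs (q - h)) ->
  (forall j, (1 <= j <= 6)%nat -> Rabs (l j) <= e) ->
  Rabs (p - h) < d ->
  20 * r <= sy h ^ 2 + (- sx h + sx h ^ 3) ^ 2 ->
  8 * (840 * K + 210) * e < sy h ^ 2 + (- sx h + sx h ^ 3) ^ 2 ->
  (forall t, 0 <= t <= T -> Rabs (x t - sx h) < r /\ Rabs (y t - sy h) < r /\
     Rabs (x t) <= 2 /\ Rabs (y t) <= 2) -> False.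
Proof.
  intros Hh Hsec (HT & Htr & Ex & Ey & Hp & ExT & EyT & _) HK HLip Hl Hpd Hr He Hnear.
  destruct (Hsec h Hh) as (Ho & _ & _).
  destruct (oval_bounds h _ _ ltac:(lra) Ho) as (Hy0 & _).
  assert (Hoh : H (sx h) (sy h) = h) by apply Ho.
  destruct Ho as [_ Hx0].
  destruct (Hsec p Hp) as ((Hop & _) & _).
  assert (He0 : 0 <= e) by (eapply Rle_trans; [apply Rabs_pos | apply (Hl 1%nat); lia]).
  assert (Hph : Rabs (p - h) <= 420 * e * T).
  { assert (B := derive_bound (fun s => H (x s) (y s))
      (fun t => friction l (x t) (y t) * y t ^ 2) 0 T (420 * e) ltac:(lra)).
    cbv beta in B; rewrite ExT, EyT, Ex, Ey, Hop, Hoh, Rminus_0_r in B.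
    apply B.
    - intros t Ht; apply (H_along l T); [exact Htr | exact Ht].
    - intros t Ht; destruct (Hnear t Ht) as (_ & _ & Bx & By).
      rewrite Rabs_mult; replace (420 * e) with (105 * e * 4) by ring.
      apply Rmult_le_compat; try apply Rabs_pos.
      + apply friction_bound; auto.
      + assert (Q1 := sqr_le_4 _ By); rewrite Rabs_pos_eq; lra. }
  set (a := sy h) in *; set (b := - sx h + sx h ^ 3) in *.
  set (N := a ^ 2 + b ^ 2) in *.
  assert (Hb : -1 <= b <= 1) by (apply cubic_bound; lra).
  rewrite trajectory_derive in Htr.
  assert (Hadv : a * x 0 + b * y 0 + N / 4 * T <= a * x T + b * y T).
  { assert (D := derive_nonpos (fun t => - (a * x t + b * y t) + N / 4 * t)
      (fun t => - (a * y t + b * (- x t + x t ^ 3 + friction l (x t) (y t) * y t)) + N / 4)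
      0 T ltac:(lra)).
    cbv beta in D; rewrite Rmult_0_r, Rplus_0_r in D.
    enough (- (a * x T + b * y T) + N / 4 * T <= - (a * x 0 + b * y 0)) by lra.
    apply D.
    - intros t Ht; destruct (Htr t Ht) as [Hx Hy]; derive_along Hx Hy; ring.
    - intros t Ht; destruct (Hnear t Ht) as (N1 & N2 & Bx & By).
      assert (S := transversal_speed (sx h) (sy h) r (x t) (y t) Hx0 Hy0 Hr N1 N2).
      fold a b N in S.
      assert (Bf := friction_bound l e _ _ Hl Bx By).
      assert (Bfy : Rabs (friction l (x t) (y t) * y t) <= 210 * e).
      { rewrite Rabs_mult; replace (210 * e) with (105 * e * 2) by ring.
        apply Rmult_le_compat; try apply Rabs_pos; assumption. }
      set (F := friction l (x t) (y t) * y t) in *.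
      apply Rabs_le_between in Bfy.
      assert (- (210 * e) <= b * F) by nra.
      assert (0 <= K * e) by (apply Rmult_le_pos; assumption).
      nra. }
  rewrite Ex, Ey, ExT, EyT in Hadv.
  destruct (HLip p Hpd) as [L1 L2].
  assert (L3 : K * Rabs (p - h) <= K * (420 * e * T)) by (apply Rmult_le_compat_l; assumption).
  set (k := K * (420 * e * T)) in *.
  assert (M1 : Rabs (sx p - sx h) <= k) by lra.
  assert (M2 : Rabs (sy p - a) <= k) by lra.
  apply Rabs_le_between in M1; apply Rabs_le_between in M2.
  assert (a * (sx p - sx h) <= k) by nra.
  assert (b * (sy p - a) <= k) by nra.
  assert (N / 4 * T <= 2 * k) by lra.
  unfold k in *.
  assert (840 * K * e < N / 8) by nra.
  assert (840 * K * e * T < N / 8 * T) by (apply Rmult_lt_compat_r; assumption).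
  assert (0 < N / 8 * T).
  { apply Rmult_lt_0_compat; [| exact HT].
    assert (0 <= K * e) by (apply Rmult_le_pos; assumption). nra. }
  lra.
Qed.

(** Near the period [T0] of the unperturbed orbit the gap to the section changes sign, so the
    first return happens before [T0 + del].  It does not happen before [T0 - del]: for times at
    most [del] this is [short_return], and between [del] and [T0 - del] the unperturbed orbit
    stays away from its starting point while the energy is nearly constant. *)
Lemma return_close (sx sy : R -> R) (h T0 eta : R) (u v : R -> R) :
  cross_section sx sy -> 0 < h < 1 / 4 -> oval_param h T0 u v ->
  u 0 = sx h -> v 0 = sy h -> 0 < eta ->
  exists rho, 0 < rho /\ forall l p T x y,
    (forall j, (1 <= j <= 6)%nat -> Rabs (l j) <= rho) ->
    return_orbit sx sy l h p T x y ->
    Rabs (T - T0) < eta /\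
    (forall t, 0 <= t <= T -> t <= T0 ->
       Rabs (x t - u t) < eta /\ Rabs (y t - v t) < eta) /\
    (forall t, 0 <= t <= T -> Rabs (x t) <= 2 /\ Rabs (y t) <= 2).
Proof.
  intros Hsec Hh Hp Eu Ev Heta.
  assert (Hbox := oval_param_box h T0 u v ltac:(lra) Hp).
  assert (Hd := oval_param_derive h T0 u v Hp).
  destruct Hp as (HT0 & Hutr & Hou & EuT & EvT & Hmin).
  destruct (Hsec h Hh) as (Hoh & Ax & Ay).
  destruct (oval_bounds h _ _ ltac:(lra) Hoh) as (Hy0 & _).
  assert (Hoh2 : H (sx h) (sy h) = h) by apply Hoh.
  destruct Hoh as [_ Hx0].
  destruct (lipschitz_at sx h (analytic_ex_derive _ _ Ax)) as (K1 & d1 & HK1 & Hd1 & HL1).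
  destruct (lipschitz_at sy h (analytic_ex_derive _ _ Ay)) as (K2 & d2 & HK2 & Hd2 & HL2).
  set (K := K1 + K2).
  destruct (small2 d1 d2 Hd1 Hd2) as (d & Hdpos & Hdd1 & Hdd2).
  assert (HLip : forall q, Rabs (q - h) < d ->
     Rabs (sx q - sx h) <= K * Rabs (q - h) /\ Rabs (sy q - sy h) <= K * Rabs (q - h)).
  { intros q Hq; assert (Q1 := Rabs_pos (q - h)).
    assert (0 <= K1 * Rabs (q - h)) by (apply Rmult_le_pos; assumption).
    assert (0 <= K2 * Rabs (q - h)) by (apply Rmult_le_pos; assumption).
    unfold K; rewrite Rmult_plus_distr_r.
    split; [eapply Rle_trans; [apply HL1 |] | eapply Rle_trans; [apply HL2 |]]; lra. }
  assert (HK : 0 <= K) by (unfold K; lra).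
  set (a := sy h) in *; set (b := - sx h + sx h ^ 3) in *.
  assert (Hb : -1 <= b <= 1) by (apply cubic_bound; lra).
  set (N := a ^ 2 + b ^ 2).
  assert (HN : 0 < N).
  { destruct (Req_dec N 0) as [Z | Z].
    - exfalso; unfold N in Z.
      assert (Q1 := pow2_ge_0 a); assert (Q2 := pow2_ge_0 b).
      assert (Ea : a = 0) by (apply Rsqr_0_uniq; unfold Rsqr; lra).
      assert (Eb : b = 0) by (apply Rsqr_0_uniq; unfold Rsqr; lra).
      assert (Es : sx h * (1 - sx h ^ 2) = 0) by (unfold b in Eb; lra).
      apply Rmult_integral in Es; destruct Es as [Es | Es]; [| nra].
      rewrite Es, Ea in Hoh2; unfold H in Hoh2; lra.
    - unfold N in *; assert (Q1 := pow2_ge_0 a); assert (Q2 := pow2_ge_0 b); lra. }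
  set (r := N / 20).
  assert (Hr : 0 < r) by (unfold r; lra).
  assert (HrN : 20 * r <= sy h ^ 2 + (- sx h + sx h ^ 3) ^ 2) by (fold a b N; unfold r; lra).
  (* Choice of [del]: for times within [del] of the ends, the unperturbed orbit is in the ball
     where the section is controlled, and on different sides of it. *)
  destruct (Hd 0 ltac:(lra)) as (Du0 & Dv0 & _); destruct (Hd T0 ltac:(lra)) as (DuT & DvT & _).
  assert (Hcont : forall (f : R -> R) (D c : R), is_derive f c D -> continuous f c).
  { intros f D c Hf; apply (ex_derive_continuous (K := R_AbsRing) (V := R_NormedModule)).
    eexists; exact Hf. }
  destruct (continuous_eps u 0 (r / 2) (Hcont _ _ _ Du0) ltac:(lra)) as (c1 & Hc1 & C1).
  destruct (continuous_eps v 0 (r / 2) (Hcont _ _ _ Dv0) ltac:(lra)) as (c2 & Hc2 & C2).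
  destruct (continuous_eps u T0 (r / 2) (Hcont _ _ _ DuT) ltac:(lra)) as (c3 & Hc3 & C3).
  destruct (continuous_eps v T0 (r / 2) (Hcont _ _ _ DvT) ltac:(lra)) as (c4 & Hc4 & C4).
  destruct (derive_pos_increasing_at (fun t => a * u t + b * v t) 0 N) as (c5 & Hc5 & C5);
    [derive_along Du0 Dv0; rewrite Eu, Ev; unfold N, b, a; ring | exact HN |].
  destruct (derive_pos_increasing_at (fun t => a * u t + b * v t) T0 N) as (c6 & Hc6 & C6);
    [derive_along DuT DvT; rewrite EuT, EvT, Eu, Ev; unfold N, b, a; ring | exact HN |].
  destruct (small_list [eta / 2; T0 / 4; c1 / 2; c2 / 2; c3 / 2; c4 / 2; c5 / 2; c6 / 2])
    as (del & Hdel & Hdl); [repeat constructor; lra |].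
  forall_inv.
  destruct (C5 del ltac:(lra)) as [G1 _]; destruct (C6 del ltac:(lra)) as [_ G2].
  rewrite Rplus_0_l, Eu, Ev in G1; rewrite EuT, EvT, Eu, Ev in G2.
  fold a in G1, G2.
  (* [mu] separates the middle part of the orbit from the starting point. *)
  destruct (continuity_ab_min (fun t => (u t - sx h) ^ 2 + (v t - a) ^ 2) del (T0 - del))
    as (tm & Hmu & Htm); [lra | |].
  { intros t Ht; destruct (Hd t ltac:(lra)) as (Du & Dv & _).
    apply continuity_pt_filterlim.
    change (continuous (fun t => (u t - sx h) ^ 2 + (v t - a) ^ 2) t).
    continuous_along Du Dv. }
  cbv beta in Hmu; set (mu := (u tm - sx h) ^ 2 + (v tm - a) ^ 2) in *.
  assert (Hmupos : 0 < mu).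
  { assert (Q1 := pow2_ge_0 (u tm - sx h)); assert (Q2 := pow2_ge_0 (v tm - a)).
    destruct (Req_dec mu 0) as [Z | Z]; [exfalso | unfold mu in *; lra].
    apply (Hmin tm ltac:(lra)); rewrite Eu, Ev; fold a; unfold mu in Z.
    split; apply Rminus_diag_uniq, Rsqr_0_uniq; unfold Rsqr; lra. }
  destruct (small_scaled [eta; r / 2; 1; d / 2; h / 2; (1 / 4 - h) / 2; mu / 4;
      (a * u del + b * v del - (a * sx h + b * a)) / 2;
      (a * sx h + b * a - (a * u (T0 - del) + b * v (T0 - del))) / 2] (50 + 50 * K))
    as (e1 & He1 & Hel); [lra | repeat constructor; lra |].
  forall_inv.
  assert (HKe : 0 <= K * e1) by (apply Rmult_le_pos; lra).
  (* The orbit is compared with the unperturbed one up to [T0], and then, restarted at [T0], with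
     the beginning of the unperturbed one; [e0] has to be an admissible initial error for
     the second comparison. *)
  destruct (close_orbits T0 e1 u v Hutr Hbox He1) as (rho2 & Hrho2 & Hclose2).
  destruct (small2 e1 rho2 He1 Hrho2) as (e0 & He0 & He01 & He02).
  destruct (close_orbits T0 e0 u v Hutr Hbox He0) as (rho1 & Hrho1 & Hclose1).
  assert (Hrho3 : 0 < N / (16 * (840 * K + 210))) by (apply Rdiv_lt_0_compat; lra).
  destruct (small3 rho1 rho2 _ Hrho1 Hrho2 Hrho3) as (rho & Hrho & Hr1 & Hr2 & Hr3).
  exists rho; split; [exact Hrho |].
  intros l p T x y Hl Horb.
  assert (Horb' := Horb); destruct Horb' as (HT & Htr & Ex & Ey & Hp & ExT & EyT & Hfirst).
  assert (P1 : forall t, 0 <= t <= T -> t <= T0 ->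
            Rabs (x t - u t) < e0 /\ Rabs (y t - v t) < e0).
  { apply Hclose1 with (l := l); [intros j Hj; specialize (Hl j Hj); lra | exact Htr | |].
    - rewrite Ex, Eu, Rminus_diag, Rabs_R0; lra.
    - rewrite Ey, Ev, Rminus_diag, Rabs_R0; lra. }
  assert (P2 : forall t, T0 <= t <= T -> t <= T0 + del ->
            Rabs (x t - u (t - T0)) < e1 /\ Rabs (y t - v (t - T0)) < e1).
  { intros t Ht Ht'.
    destruct (P1 T0 ltac:(lra) ltac:(lra)) as [Q1 Q2].
    assert (Hc := Hclose2 l (T - T0) (fun s => x (s + T0)) (fun s => y (s + T0))
      ltac:(intros j Hj; specialize (Hl j Hj); lra)
      (trajectory_shift l T T0 x y ltac:(lra) Htr)).
    cbv beta in Hc; rewrite Rplus_0_l, <- EuT, <- EvT in Hc.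
    specialize (Hc ltac:(lra) ltac:(lra) (t - T0) ltac:(lra) ltac:(lra)).
    replace (t - T0 + T0) with t in Hc by ring; exact Hc. }
  assert (Hnear : forall z w s, 0 <= s <= T0 -> Rabs (z - u s) < e1 -> Rabs (w - v s) < e1 ->
     (Rabs z <= 2 /\ Rabs w <= 2) /\ 0 < H z w < 1 / 4 /\ Rabs (H z w - h) < d /\
     Rabs (sx (H z w) - sx h) <= K * (24 * e1) /\ Rabs (sy (H z w) - a) <= K * (24 * e1)).
  { intros z w s Hs Hz Hw.
    destruct (Hbox s Hs) as [B1 B2]; destruct (Hd s Hs) as (_ & _ & EH).
    assert (B3 : Rabs z <= 2) by (rabs; apply Rabs_le; lra).
    assert (B4 : Rabs w <= 2) by (rabs; apply Rabs_le; lra).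
    assert (BH : Rabs (H z w - h) <= 24 * e1).
    { rewrite <- EH; apply H_lipschitz; lra. }
    assert (BH' := BH); apply Rabs_le_between in BH'.
    destruct (HLip (H z w) ltac:(lra)) as [L1 L2].
    assert (K * Rabs (H z w - h) <= K * (24 * e1)) by (apply Rmult_le_compat_l; lra).
    repeat split; try lra; unfold a; lra. }
  assert (Hball1 : forall s, 0 <= s <= del -> Rabs (u s - sx h) < r / 2 /\ Rabs (v s - a) < r / 2).
  { intros s Hs; rewrite <- Eu; rewrite <- Ev.
    split; [apply C1 | apply C2]; rewrite Rminus_0_r; apply Rabs_def1; lra. }
  assert (Hball2 : forall s, T0 - del <= s <= T0 ->
            Rabs (u s - sx h) < r / 2 /\ Rabs (v s - a) < r / 2).
  { intros s Hs; rewrite <- Eu, <- EuT; rewrite <- Ev, <- EvT.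
    split; [apply C3 | apply C4]; apply Rabs_def1; lra. }
  assert (Hupper : T <= T0 + del).
  { destruct (Rle_lt_dec T (T0 + del)) as [L1 | L1]; [exact L1 | exfalso].
    assert (Hat : forall t, T0 - del <= t <= T0 + del -> exists s,
      0 <= s <= T0 /\ Rabs (x t - u s) < e1 /\ Rabs (y t - v s) < e1 /\
      Rabs (u s - sx h) < r / 2 /\ Rabs (v s - a) < r / 2).
    { intros t Ht; destruct (Rle_lt_dec t T0) as [L2 | L2].
      - exists t; destruct (P1 t ltac:(lra) L2); destruct (Hball2 t ltac:(lra)).
        repeat split; try lra; assumption.
      - exists (t - T0); destruct (P2 t ltac:(lra) ltac:(lra));
          destruct (Hball1 (t - T0) ltac:(lra)).
        repeat split; try lra; assumption. }
    assert (Hgap : forall z w s, 0 <= s <= T0 -> Rabs (z - u s) < e1 -> Rabs (w - v s) < e1 ->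
      Rabs (section_gap sx sy a b z w - (a * u s + b * v s - (a * sx h + b * a)))
        <= 2 * e1 + 2 * (K * (24 * e1))).
    { intros z w s Hs Hz Hw; destruct (Hnear z w s Hs Hz Hw) as (_ & _ & _ & M1 & M2).
      unfold section_gap; set (qx := sx (H z w)) in *; set (qy := sy (H z w)) in *.
      replace (a * (z - qx) + b * (w - qy) - (a * u s + b * v s - (a * sx h + b * a)))
        with (a * (z - u s - (qx - sx h)) + b * (w - v s - (qy - a))) by ring.
      assert (M3 : Rabs (z - u s - (qx - sx h)) <= e1 + K * (24 * e1))
        by (rabs; apply Rabs_le; lra).
      assert (M4 : Rabs (w - v s - (qy - a)) <= e1 + K * (24 * e1))
        by (rabs; apply Rabs_le; lra).
      eapply Rle_trans; [apply Rabs_triang |]; rewrite !Rabs_mult.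
      assert (Rabs a <= 1) by (apply Rabs_le; lra).
      assert (Rabs b <= 1) by (apply Rabs_le; lra).
      assert (Q1 := Rabs_pos a); assert (Q2 := Rabs_pos b).
      assert (Q3 := Rabs_pos (z - u s - (qx - sx h))).
      assert (Q4 := Rabs_pos (w - v s - (qy - a))). nra. }
    destruct (section_crossing sx sy h (T0 - del) (T0 + del) r x y) as (t & q & Ht & Hq & E1 & E2);
      auto; [lra | | | | |].
    - intros t Ht; destruct (Htr t ltac:(lra)) as [Dx Dy]; split; eexists; eassumption.
    - intros t Ht; destruct (Hat t Ht) as (s & Hs & M1 & M2 & M3 & M4).
      destruct (Hnear _ _ s Hs M1 M2) as (_ & M5 & _ & M6 & M7).
      fold a; rabs; repeat split; try lra; apply Rabs_def1; lra.
    - destruct (P1 (T0 - del) ltac:(lra) ltac:(lra)) as [M1 M2].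
      apply (Rlt_le_trans _ _ e1) in M1; [| exact He01].
      apply (Rlt_le_trans _ _ e1) in M2; [| exact He01].
      assert (M := Hgap _ _ (T0 - del) ltac:(lra) M1 M2).
      apply Rabs_le_between in M; fold a b; lra.
    - destruct (P2 (T0 + del) ltac:(lra) ltac:(lra)) as [M1 M2].
      replace (T0 + del - T0) with del in M1, M2 by ring.
      assert (M := Hgap _ _ del ltac:(lra) M1 M2).
      apply Rabs_le_between in M; fold a b; lra.
    - apply (Hfirst t q); [lra | exact Hq | split; assumption]. }
  assert (Hlower : T0 - del <= T).
  { destruct (Rle_lt_dec (T0 - del) T) as [L1 | L1]; [exact L1 | exfalso].
    destruct (P1 T ltac:(lra) ltac:(lra)) as [M1 M2].
    apply (Rlt_le_trans _ _ e1) in M1; [| exact He01].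
    apply (Rlt_le_trans _ _ e1) in M2; [| exact He01].
    destruct (Hnear _ _ T ltac:(lra) M1 M2) as (_ & _ & M3 & M4 & M5).
    assert (EH : H (x T) (y T) = p) by (rewrite ExT, EyT; apply (Hsec p Hp)).
    rewrite EH in M3, M4, M5.
    destruct (Rle_lt_dec T del) as [L2 | L2].
    - apply (short_return sx sy h p T rho K d r l x y); auto.
      + fold a b N.
        apply (Rmult_le_compat_r (16 * (840 * K + 210))) in Hr3; [| lra].
        replace (N / (16 * (840 * K + 210)) * (16 * (840 * K + 210))) with N in Hr3
          by (field; lra). lra.
      + intros t Ht; destruct (P1 t Ht ltac:(lra)) as [W1 W2].
        destruct (Hball1 t ltac:(lra)) as [W3 W4].
        apply (Rlt_le_trans _ _ e1) in W1; [| exact He01].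
        apply (Rlt_le_trans _ _ e1) in W2; [| exact He01].
        destruct (Hnear _ _ t ltac:(lra) W1 W2) as ((W5 & W6) & _).
        fold a; repeat split; try assumption; rabs; apply Rabs_def1; lra.
    - specialize (Hmu T ltac:(lra)).
      rewrite ExT in M1; rewrite EyT in M2; rabs.
      set (m := e1 + K * (24 * e1)).
      assert (Hm : 0 < m <= 1) by (unfold m; lra).
      assert (W1 : (u T - sx h) ^ 2 <= m)
        by (assert (- m <= u T - sx h <= m) by (unfold m; lra); nra).
      assert (W2 : (v T - a) ^ 2 <= m)
        by (assert (- m <= v T - a <= m) by (unfold m; lra); nra).
      assert (2 * m < mu) by (unfold m; lra). lra. }
  split; [apply Rabs_def1; lra |]; split.
  - intros t Ht Ht0; destruct (P1 t Ht Ht0); lra.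
  - intros t Ht; destruct (Rle_lt_dec t T0) as [L2 | L2].
    + destruct (P1 t Ht L2); apply (Hnear _ _ t); lra.
    + destruct (P2 t ltac:(lra) ltac:(lra)); apply (Hnear _ _ (t - T0)); lra.
Qed.

(** * Uniform limits of integrals along the orbits *)

(** Uniform convergence on the square where all the orbits lie, combined with uniform
    continuity of the limit, in a form that is stable under sums and products.  The bound on
    the limit is included for the sake of products. *)
Definition conv_on_box (G : R -> R -> R -> R) (G0 : R -> R -> R) : Prop :=
  (exists B, 0 <= B /\ forall u v, Rabs u <= 2 -> Rabs v <= 2 -> Rabs (G0 u v) <= B) /\
  forall eta, 0 < eta -> exists del, 0 < del /\
    locally' 0 (fun e => forall x y u v,
      Rabs x <= 2 -> Rabs y <= 2 -> Rabs u <= 2 -> Rabs v <= 2 ->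
      Rabs (x - u) < del -> Rabs (y - v) < del -> Rabs (G e x y - G0 u v) < eta).

Lemma conv_on_box_param (p : R -> R) (p0 : R) :
  tends p p0 -> conv_on_box (fun e _ _ => p e) (fun _ _ => p0).
Proof.
  intros Hp; split.
  - exists (Rabs p0); split; [apply Rabs_pos |]; intros; lra.
  - intros eta Heta; exists 1; split; [lra |].
    generalize (tends_eps p p0 eta Hp Heta); apply filter_imp; intros; assumption.
Qed.

Lemma conv_on_box_x : conv_on_box (fun _ x _ => x) (fun u _ => u).
Proof.
  split; [exists 2; split; [lra |]; intros; assumption |].
  intros eta Heta; exists eta; split; [exact Heta |].
  apply filter_forall; intros; assumption.
Qed.

Lemma conv_on_box_y : conv_on_box (fun _ _ y => y) (fun _ v => v).
Proof.
  split; [exists 2; split; [lra |]; intros; assumption |].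
  intros eta Heta; exists eta; split; [exact Heta |].
  apply filter_forall; intros; assumption.
Qed.

Lemma conv_on_box_plus (F G : R -> R -> R -> R) (F0 G0 : R -> R -> R) :
  conv_on_box F F0 -> conv_on_box G G0 ->
  conv_on_box (fun e x y => F e x y + G e x y) (fun u v => F0 u v + G0 u v).
Proof.
  intros [(B1 & HB1 & Hb1) HF] [(B2 & HB2 & Hb2) HG]; split.
  - exists (B1 + B2); split; [lra |]; intros u v Hu Hv.
    eapply Rle_trans; [apply Rabs_triang |].
    specialize (Hb1 u v Hu Hv); specialize (Hb2 u v Hu Hv); lra.
  - intros eta Heta.
    destruct (HF (eta / 2) ltac:(lra)) as (d1 & Hd1 & L1).
    destruct (HG (eta / 2) ltac:(lra)) as (d2 & Hd2 & L2).
    destruct (small2 d1 d2 Hd1 Hd2) as (d & Hd & Hdd1 & Hdd2).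
    exists d; split; [exact Hd |].
    generalize (filter_and (F := locally' 0) _ _ L1 L2); apply filter_imp.
    intros e [K1 K2] x y u v Hx Hy Hu Hv Hxu Hyv.
    specialize (K1 x y u v Hx Hy Hu Hv ltac:(lra) ltac:(lra)).
    specialize (K2 x y u v Hx Hy Hu Hv ltac:(lra) ltac:(lra)).
    replace (F e x y + G e x y - (F0 u v + G0 u v))
      with ((F e x y - F0 u v) + (G e x y - G0 u v)) by ring.
    eapply Rle_lt_trans; [apply Rabs_triang | lra].
Qed.

Lemma conv_on_box_mult (F G : R -> R -> R -> R) (F0 G0 : R -> R -> R) :
  conv_on_box F F0 -> conv_on_box G G0 ->
  conv_on_box (fun e x y => F e x y * G e x y) (fun u v => F0 u v * G0 u v).
Proof.
  intros [(B1 & HB1 & Hb1) HF] [(B2 & HB2 & Hb2) HG]; split.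
  - exists (B1 * B2); split; [apply Rmult_le_pos; lra |]; intros u v Hu Hv.
    rewrite Rabs_mult; apply Rmult_le_compat; auto using Rabs_pos.
  - intros eta Heta.
    destruct (small_scaled [1; eta / 4] (1 + B1 + B2)) as (r & Hr & Hrl);
      [lra | repeat constructor; lra |]; forall_inv.
    destruct (HF r Hr) as (d1 & Hd1 & L1); destruct (HG r Hr) as (d2 & Hd2 & L2).
    destruct (small2 d1 d2 Hd1 Hd2) as (d & Hd & Hdd1 & Hdd2).
    exists d; split; [exact Hd |].
    generalize (filter_and (F := locally' 0) _ _ L1 L2); apply filter_imp.
    intros e [K1 K2] x y u v Hx Hy Hu Hv Hxu Hyv.
    specialize (K1 x y u v Hx Hy Hu Hv ltac:(lra) ltac:(lra)).
    specialize (K2 x y u v Hx Hy Hu Hv ltac:(lra) ltac:(lra)).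
    specialize (Hb1 u v Hu Hv); specialize (Hb2 u v Hu Hv).
    replace (F e x y * G e x y - F0 u v * G0 u v)
      with ((F e x y - F0 u v) * (G e x y - G0 u v)
        + ((F e x y - F0 u v) * G0 u v + F0 u v * (G e x y - G0 u v))) by ring.
    set (f := F e x y - F0 u v) in *; set (g := G e x y - G0 u v) in *.
    assert (Q1 := Rabs_pos f); assert (Q2 := Rabs_pos g).
    assert (Q3 := Rabs_pos (F0 u v)); assert (Q4 := Rabs_pos (G0 u v)).
    assert (T1 : Rabs (f * g) <= r * r)
      by (rewrite Rabs_mult; apply Rmult_le_compat; lra).
    assert (T2 : Rabs (f * G0 u v) <= r * B2)
      by (rewrite Rabs_mult; apply Rmult_le_compat; lra).
    assert (T3 : Rabs (F0 u v * g) <= B1 * r)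
      by (rewrite Rabs_mult; apply Rmult_le_compat; lra).
    assert (T4 := Rabs_triang (f * g) (f * G0 u v + F0 u v * g)).
    assert (T5 := Rabs_triang (f * G0 u v) (F0 u v * g)).
    assert (r <= 1) by nra.
    nra.
Qed.

Lemma conv_on_box_pow (F : R -> R -> R -> R) (F0 : R -> R -> R) (n : nat) :
  conv_on_box F F0 -> conv_on_box (fun e x y => F e x y ^ n) (fun u v => F0 u v ^ n).
Proof.
  intros HF; induction n as [| n IH]; simpl.
  - apply (conv_on_box_param (fun _ => 1)), tends_const.
  - apply conv_on_box_mult; assumption.
Qed.

Lemma conv_on_box_ext (F G : R -> R -> R -> R) (F0 G0 : R -> R -> R) :
  (forall e x y, F e x y = G e x y) -> (forall u v, F0 u v = G0 u v) ->
  conv_on_box F F0 -> conv_on_box G G0.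
Proof.
  intros EF E0 [(B & HB & Hb) HF]; split.
  - exists B; split; [exact HB |]; intros u v Hu Hv; rewrite <- E0; auto.
  - intros eta Heta; destruct (HF eta Heta) as (d & Hd & L1).
    exists d; split; [exact Hd |]; revert L1; apply filter_imp.
    intros e He x y u v; rewrite <- E0, <- EF; apply He.
Qed.

Definition along_continuous (F : R -> R -> R) : Prop :=
  forall (x y : R -> R) (t : R), ex_derive x t -> ex_derive y t ->
  continuous (fun s => F (x s) (y s)) t.

Lemma integral_limit (sx sy : R -> R) (h T0 : R) (u v : R -> R) (lam : nat -> R -> R)
  (G : R -> R -> R -> R) (G0 : R -> R -> R) :
  cross_section sx sy -> 0 < h < 1 / 4 -> oval_param h T0 u v ->
  u 0 = sx h -> v 0 = sy h ->
  (forall j, (1 <= j <= 6)%nat -> tends (lam j) 0) ->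
  conv_on_box G G0 -> (forall e, along_continuous (G e)) -> along_continuous G0 ->
  forall eta, 0 < eta ->
  locally' 0 (fun e => forall p T x y,
    return_orbit sx sy (fun j => lam j e) h p T x y ->
    Rabs (RInt (fun t => G e (x t) (y t)) 0 T - RInt (fun t => G0 (u t) (v t)) 0 T0) < eta).
Proof.
  intros Hsec Hh Hp Eu Ev Hlam [(B & HB & Hb) HG] HGc HG0c eta Heta.
  assert (HT0 : 0 < T0) by (destruct Hp; lra).
  assert (Hd := oval_param_derive h T0 u v Hp).
  assert (Hbox := oval_param_box h T0 u v ltac:(lra) Hp).
  destruct (small_scaled [1; eta / 4] (1 + T0)) as (e1 & He1 & Hel);
    [lra | repeat constructor; lra |]; forall_inv.
  assert (He11 : e1 <= 1) by nra.
  destruct (HG e1 He1) as (del & Hdel & HGdel).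
  destruct (small_scaled [eta / 4; del] (1 + B)) as (e2 & He2 & Hel2);
    [lra | repeat constructor; lra |]; forall_inv.
  assert (He2d : e2 <= del) by nra.
  destruct (return_close sx sy h T0 e2 u v Hsec Hh Hp Eu Ev He2) as (rho & Hrho & Hclose).
  assert (Hlam' : forall j, (1 <= j <= 6)%nat -> locally' 0 (fun e => Rabs (lam j e) < rho)).
  { intros j Hj; generalize (tends_eps _ _ rho (Hlam j Hj) Hrho); apply filter_imp.
    intros e He; rewrite Rminus_0_r in He; exact He. }
  assert (Hall : locally' 0 (fun e => forall j, (1 <= j <= 6)%nat -> Rabs (lam j e) <= rho)).
  { generalize (filter_and (F := locally' 0) _ _ (Hlam' 1%nat ltac:(lia))
      (filter_and (F := locally' 0) _ _ (Hlam' 2%nat ltac:(lia))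
      (filter_and (F := locally' 0) _ _ (Hlam' 3%nat ltac:(lia))
      (filter_and (F := locally' 0) _ _ (Hlam' 4%nat ltac:(lia))
      (filter_and (F := locally' 0) _ _ (Hlam' 5%nat ltac:(lia)) (Hlam' 6%nat ltac:(lia))))))).
    apply filter_imp; intros e (L1 & L2 & L3 & L4 & L5 & L6) j Hj; left.
    do 7 (destruct j as [| j]; [first [assumption | lia] |]); lia. }
  generalize (filter_and (F := locally' 0) _ _ Hall HGdel); apply filter_imp.
  intros e [Hl HGe] p T x y Horb.
  destruct (Hclose (fun j => lam j e) p T x y Hl Horb) as (HTT & Hxy & Hbxy).
  destruct Horb as (HT & Htr & _); rewrite trajectory_derive in Htr.
  assert (Hcmp := RInt_compare (fun t => G e (x t) (y t)) (fun t => G0 (u t) (v t))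
    T T0 e1 (B + 1) ltac:(lra) ltac:(lra)).
  eapply Rle_lt_trans; [apply Hcmp |].
  - intros t Ht; destruct (Htr t Ht) as [Dx Dy]; split.
    + apply HGc; eexists; eassumption.
    + destruct (Hbxy t Ht) as [Bx By].
      assert (Hg := HGe (x t) (y t) (x t) (y t) Bx By Bx By
        ltac:(rewrite Rminus_diag, Rabs_R0; exact Hdel)
        ltac:(rewrite Rminus_diag, Rabs_R0; exact Hdel)).
      specialize (Hb (x t) (y t) Bx By); rabs; apply Rabs_le; lra.
  - intros t Ht; destruct (Hd t Ht) as (Du & Dv & _); split.
    + apply HG0c; eexists; eassumption.
    + destruct (Hbox t Ht); assert (Hg := Hb (u t) (v t) ltac:(lra) ltac:(lra)); lra.
  - intros t Ht Ht0; destruct (Hxy t Ht Ht0) as [C1 C2]; destruct (Hbxy t Ht) as [Bx By].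
    destruct (Hbox t ltac:(lra)) as [B1 B2].
    left; apply HGe; lra.
  - assert (P := Rabs_pos (T - T0)).
    assert (Rabs (T - T0) * (B + 1) <= e2 * (B + 1)) by (apply Rmult_le_compat_r; lra).
    nra.
Qed.

(** * The first nonzero coefficient of the displacement *)

(** Each correction cancels the part of the derivative of the previous expression that is a
    multiple of [a], respectively [a ^ 2]. *)
Definition corrected_energy (a x y : R) : R := H x y - a * (x * y ^ 3) + 3 * a ^ 2 * secondary x y.

(** The derivative of the corrected energy for the friction [a exact_friction + friction g], with
    [k = a ^ 3].  The cube is a separate argument so that it can be divided by [eps ^ n] on its
    own. *)
Definition corrected_rate (k a : R) (g : nat -> R) (x y : R) : R :=
  k * (3 * exact_friction x y * secondary_rate x y * y ^ 2)
  + friction g x y * y ^ 2 * (1 - 3 * a * (x * y) + 3 * a ^ 2 * secondary_rate x y).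

Lemma corrected_energy_along (l : nat -> R) (T : R) (x y : R -> R) :
  trajectory l T x y -> forall t, 0 <= t <= T ->
  is_derive (fun s => corrected_energy (l 3%nat) (x s) (y s)) t
    (corrected_rate (l 3%nat ^ 3) (l 3%nat) (reduced l) (x t) (y t)).
Proof.
  rewrite trajectory_derive; intros Htr t Ht; destruct (Htr t Ht) as [Hx Hy].
  rewrite friction_reduced in Hy.
  unfold corrected_energy, H, secondary; derive_along Hx Hy.
  unfold corrected_rate, exact_friction, secondary_rate; field.
Qed.

Lemma corrected_rate_scal (k a s : R) (g : nat -> R) (x y : R) :
  corrected_rate k a g x y / s = corrected_rate (k / s) a (fun j => g j / s) x y.
Proof. unfold corrected_rate, friction, Rdiv; ring. Qed.

Lemma corrected_rate_0 (k : R) (g : nat -> R) (x y : R) :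
  corrected_rate k 0 g x y = melnikov_integrand k g x y.
Proof. unfold corrected_rate, melnikov_integrand; ring. Qed.

Lemma along_continuous_rate (k a : R) (g : nat -> R) : along_continuous (corrected_rate k a g).
Proof.
  intros x y t [d1 Hx] [d2 Hy].
  unfold corrected_rate, friction, exact_friction, secondary_rate; continuous_along Hx Hy.
Qed.

Ltac conv_on_box_tac :=
  repeat first
    [ apply conv_on_box_x | apply conv_on_box_y
    | apply conv_on_box_plus | apply conv_on_box_mult | apply conv_on_box_pow ];
  try (apply conv_on_box_param; first [assumption | apply tends_const]).

Lemma conv_on_box_rate (k a : R -> R) (g : R -> nat -> R) (k0 : R) (g0 : nat -> R) :
  tends k k0 -> tends a 0 ->
  (forall j, (1 <= j <= 6)%nat -> tends (fun e => g e j) (g0 j)) ->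
  conv_on_box (fun e => corrected_rate (k e) (a e) (g e)) (melnikov_integrand k0 g0).
Proof.
  intros Hk Ha Hg.
  assert (G1 := Hg 1%nat ltac:(lia)); assert (G2 := Hg 2%nat ltac:(lia)).
  assert (G3 := Hg 3%nat ltac:(lia)); assert (G4 := Hg 4%nat ltac:(lia)).
  assert (G5 := Hg 5%nat ltac:(lia)); assert (G6 := Hg 6%nat ltac:(lia)).
  assert (CQ : conv_on_box (fun _ => exact_friction) exact_friction).
  { apply (conv_on_box_ext (fun _ x y => y ^ 2 + ((-3) * x ^ 2 + 3 * x ^ 4))
      (fun _ => exact_friction) (fun x y => y ^ 2 + ((-3) * x ^ 2 + 3 * x ^ 4)));
      [intros; unfold exact_friction; ring .. | conv_on_box_tac]. }
  assert (CR : conv_on_box (fun _ => secondary_rate) secondary_rate).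
  { apply (conv_on_box_ext
      (fun _ x y => 2 * x ^ 2 * y ^ 2 + ((-1 / 2) * x ^ 4 + (1 / 3) * x ^ 6))
      (fun _ => secondary_rate)
      (fun x y => 2 * x ^ 2 * y ^ 2 + ((-1 / 2) * x ^ 4 + (1 / 3) * x ^ 6)));
      [intros; unfold secondary_rate; field .. | conv_on_box_tac]. }
  assert (CF : conv_on_box (fun e => friction (g e)) (friction g0))
    by (unfold friction; conv_on_box_tac).
  apply (conv_on_box_ext
    (fun e x y => k e * (3 * exact_friction x y * secondary_rate x y * y ^ 2)
      + friction (g e) x y * y ^ 2
        * (1 + (((-3) * a e) * (x * y) + (3 * a e ^ 2) * secondary_rate x y)))
    _
    (fun x y => k0 * (3 * exact_friction x y * secondary_rate x y * y ^ 2)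
      + friction g0 x y * y ^ 2
        * (1 + (((-3) * 0) * (x * y) + (3 * 0 ^ 2) * secondary_rate x y)))).
  - intros; unfold corrected_rate; ring.
  - intros; unfold melnikov_integrand; ring.
  - apply conv_on_box_plus.
    + apply conv_on_box_mult; [apply conv_on_box_param, Hk |].
      apply conv_on_box_mult; [| conv_on_box_tac].
      apply conv_on_box_mult; [| exact CR].
      apply conv_on_box_mult; [conv_on_box_tac | exact CQ].
    + apply conv_on_box_mult; [apply conv_on_box_mult; [exact CF | conv_on_box_tac] |].
      apply conv_on_box_plus; [conv_on_box_tac |].
      apply conv_on_box_plus.
      * apply conv_on_box_mult; [| conv_on_box_tac].
        apply (conv_on_box_param (fun e => -3 * a e)), tends_mult; [apply tends_const | exact Ha].
      * apply conv_on_box_mult; [| exact CR].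
        apply (conv_on_box_param (fun e => 3 * a e ^ 2)), tends_mult;
          [apply tends_const | apply tends_pow, Ha].
Qed.

Lemma expansion_reduced (lam : nat -> R -> R) (c : nat -> nat -> R) :
  (forall j, (1 <= j <= 6)%nat -> expansion (c j) (lam j)) ->
  forall j, (1 <= j <= 6)%nat ->
  expansion (fun k => reduced (fun i => c i k) j) (fun e => reduced (fun i => lam i e) j).
Proof.
  intros Hlam j Hj.
  assert (L2 := expansion_lin _ _ _ _ 3 (Hlam 2%nat ltac:(lia)) (Hlam 3%nat ltac:(lia))).
  assert (L4 := expansion_lin _ _ _ _ (-3) (Hlam 4%nat ltac:(lia)) (Hlam 3%nat ltac:(lia))).
  destruct j as [| [| [| [| [| [| [| j]]]]]]]; try lia; simpl.
  - apply (Hlam 1%nat); lia.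
  - exact L2.
  - unfold expansion; apply filter_forall; intros e.
    apply (is_series_ext (fun _ => 0)); [intros; to_R; ring |].
    apply (filterlim_ext (fun _ => 0)); [intros; rewrite sum_n_const; to_R; ring |].
    apply filterlim_const.
  - unfold expansion in *; revert L4; apply filter_imp; intros e He.
    replace (lam 4%nat e - 3 * lam 3%nat e) with (lam 4%nat e + -3 * lam 3%nat e) by ring.
    revert He; apply is_series_ext; intros; to_R; ring.
  - apply (Hlam 5%nat); lia.
  - apply (Hlam 6%nat); lia.
Qed.

(** Along the section the corrected energy differs from the energy by [a] times functions that
    are Lipschitz at [h], so the correction changes the displacement by a factor [1 + O(a)] only. *)
Lemma corrected_energy_section (sx sy : R -> R) (h m : R) (n : nat) (a p : R -> R) :
  cross_section sx sy -> 0 < h < 1 / 4 ->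
  tends a 0 -> tends (fun e => p e - h) 0 -> tends (fun e => (p e - h) / e ^ n) m ->
  locally' 0 (fun e => 0 < p e < 1 / 4) ->
  tends (fun e => (corrected_energy (a e) (sx (p e)) (sy (p e))
    - corrected_energy (a e) (sx h) (sy h)) / e ^ n) m.
Proof.
  intros Hsec Hh Ha Hp Hm Hp14.
  destruct (Hsec h Hh) as ((Hoh & _) & Ax & Ay).
  destruct (analytic_ex_derive _ _ Ax) as [dx Dx].
  destruct (analytic_ex_derive _ _ Ay) as [dy Dy].
  destruct (lipschitz_at (fun q => sx q * sy q ^ 3) h) as (K1 & d1 & HK1 & Hd1 & L1).
  { auto_derive; repeat split; eexists; eassumption. }
  destruct (lipschitz_at (fun q => secondary (sx q) (sy q)) h) as (K2 & d2 & HK2 & Hd2 & L2).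
  { unfold secondary; auto_derive; repeat split; eexists; eassumption. }
  set (D := fun e => (p e - h) / e ^ n) in *.
  set (Z := fun e => (corrected_energy (a e) (sx (p e)) (sy (p e))
    - corrected_energy (a e) (sx h) (sy h)) / e ^ n).
  apply (tends_ext (fun e => D e + (Z e - D e))); [apply filter_forall; intros; ring |].
  replace m with (m + 0) by ring; apply tends_plus; [exact Hm |].
  apply (tends_dominated _ (fun e => Rabs (D e) * (K1 * Rabs (a e) + 3 * K2 * a e ^ 2))).
  - destruct (small2 d1 d2 Hd1 Hd2) as (d & Hd & Hdd1 & Hdd2).
    assert (Hne : locally' 0 (fun e => e <> 0))
      by (exists (mkposreal 1 Rlt_0_1); intros e _ He; exact He).
    generalize (filter_and (F := locally' 0) _ _ Hne
      (filter_and (F := locally' 0) _ _ Hp14 (tends_eps _ 0 d Hp Hd))).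
    apply filter_imp; intros e (He & Hpe & Hpd).
    rewrite Rminus_0_r in Hpd.
    specialize (L1 (p e) ltac:(lra)); specialize (L2 (p e) ltac:(lra)); cbv beta in L1, L2.
    assert (Hpow : e ^ n <> 0) by (apply pow_nonzero, He).
    destruct (Hsec (p e) Hpe) as ((Hop & _) & _).
    set (s1 := sx (p e) * sy (p e) ^ 3 - sx h * sy h ^ 3) in *.
    set (s2 := secondary (sx (p e)) (sy (p e)) - secondary (sx h) (sy h)) in *.
    replace (Z e - D e) with ((- a e * s1 + 3 * a e ^ 2 * s2) / e ^ n).
    2: { unfold Z, D, corrected_energy; rewrite Hop, Hoh; unfold s1, s2; field; exact Hpow. }
    unfold D, Rdiv; rewrite !Rabs_mult.
    replace (Rabs (p e - h) * Rabs (/ e ^ n) * (K1 * Rabs (a e) + 3 * K2 * a e ^ 2))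
      with ((Rabs (a e) * (K1 * Rabs (p e - h)) + 3 * a e ^ 2 * (K2 * Rabs (p e - h)))
        * Rabs (/ e ^ n)) by ring.
    apply Rmult_le_compat_r; [apply Rabs_pos |].
    eapply Rle_trans; [apply Rabs_triang |]; rewrite !Rabs_mult, Rabs_Ropp.
    assert (P1 := pow2_ge_0 (a e)).
    rewrite (Rabs_pos_eq 3), (Rabs_pos_eq (a e ^ 2)) by lra.
    apply Rplus_le_compat; apply Rmult_le_compat_l; auto using Rabs_pos; lra.
  - replace 0 with (Rabs m * (K1 * Rabs 0 + 3 * K2 * 0 ^ 2))
      by (rewrite Rabs_R0; ring).
    apply tends_mult; [apply tends_abs, Hm |].
    apply tends_plus; apply tends_mult;
      [apply tends_const | apply tends_abs, Ha | apply tends_const | apply tends_pow, Ha].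
Qed.

Lemma melnikov_limit (lam : nat -> R -> R) (c : nat -> nat -> R) (sx sy : R -> R)
  (p : R -> R) (M : nat -> R) (n : nat) (h T0 kappa : R) (u v : R -> R) :
  (forall j, (1 <= j <= 6)%nat -> expansion (c j) (lam j)) ->
  cross_section sx sy -> 0 < h < 1 / 4 ->
  locally 0 (fun e => first_return sx sy (fun j => lam j e) h (p e)) ->
  expansion M (fun e => p e - h) -> (1 <= n)%nat ->
  (forall k, (1 <= k < n)%nat -> M k = 0) ->
  (forall k j, (1 <= k < n)%nat -> (1 <= j <= 6)%nat -> reduced (fun i => c i k) j = 0) ->
  tends (fun e => lam 3%nat e ^ 3 / e ^ n) kappa ->
  oval_param h T0 u v -> u 0 = sx h -> v 0 = sy h ->
  M n = RInt (fun t => melnikov_integrand kappa (reduced (fun j => c j n)) (u t) (v t)) 0 T0.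
Proof.
  intros Hlam Hsec Hh HP HM Hn HMk Hred Hkappa Hp Eu Ev.
  set (I := RInt (fun t => melnikov_integrand kappa (reduced (fun j => c j n)) (u t) (v t)) 0 T0).
  assert (Hlam0 : forall j, (1 <= j <= 6)%nat -> tends (lam j) 0)
    by (intros j Hj; eapply expansion_tends_0, Hlam, Hj).
  assert (HP' : locally' 0 (fun e => exists T x y,
    return_orbit sx sy (fun j => lam j e) h (p e) T x y)).
  { apply (filter_le_within (F := locally 0)); exact HP. }
  assert (Hg : forall j, (1 <= j <= 6)%nat ->
    tends (fun e => reduced (fun i => lam i e) j / e ^ n) (reduced (fun i => c i n) j)).
  { intros j Hj.
    apply (expansion_lead (fun k => reduced (fun i => c i k) j)
      (fun e => reduced (fun i => lam i e) j)); auto.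
    apply expansion_reduced; assumption. }
  set (Z := fun e => (corrected_energy (lam 3%nat e) (sx (p e)) (sy (p e))
    - corrected_energy (lam 3%nat e) (sx h) (sy h)) / e ^ n).
  apply (tends_unique Z).
  - apply corrected_energy_section; auto.
    + apply Hlam0; lia.
    + eapply expansion_tends_0; exact HM.
    + apply expansion_lead; assumption.
    + revert HP'; apply filter_imp; intros e (T & x & y & Horb).
      destruct Horb as (_ & _ & _ & _ & Hpe & _); exact Hpe.
  - apply filterlim_locally; intros [eta Heta].
    assert (Hlim := integral_limit sx sy h T0 u v lam
      (fun e => corrected_rate (lam 3%nat e ^ 3 / e ^ n) (lam 3%nat e)
         (fun j => reduced (fun i => lam i e) j / e ^ n))
      (melnikov_integrand kappa (reduced (fun j => c j n)))
      Hsec Hh Hp Eu Ev Hlam0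
      (conv_on_box_rate _ _ _ _ _ Hkappa (Hlam0 3%nat ltac:(lia)) Hg)
      (fun e => along_continuous_rate _ _ _)).
    assert (Hc : along_continuous (melnikov_integrand kappa (reduced (fun j => c j n)))).
    { intros x y t Dx Dy.
      apply (continuous_ext
        (fun s => corrected_rate kappa 0 (reduced (fun j => c j n)) (x s) (y s)));
        [intros; apply corrected_rate_0 | apply along_continuous_rate; assumption]. }
    generalize (filter_and (F := locally' 0) _ _ HP' (Hlim Hc eta Heta)).
    apply filter_imp; intros e [(T & x & y & Horb) Hint].
    specialize (Hint (p e) T x y Horb).
    destruct Horb as (HT & Htr & Ex & Ey & _ & ExT & EyT & _).
    assert (EZ : is_RInt (fun t => corrected_rate (lam 3%nat e ^ 3 / e ^ n) (lam 3%nat e)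
         (fun j => reduced (fun i => lam i e) j / e ^ n) (x t) (y t)) 0 T (Z e)).
    { unfold Z; rewrite <- ExT, <- EyT, <- Ex, <- Ey.
      apply (is_RInt_ext (fun t => scal (/ e ^ n) (corrected_rate (lam 3%nat e ^ 3) (lam 3%nat e)
         (reduced (fun i => lam i e)) (x t) (y t)))).
      - intros t _; rewrite <- corrected_rate_scal; unfold scal; simpl; unfold mult; simpl.
        unfold Rdiv; ring.
      - match goal with |- is_RInt _ _ _ ?w =>
          replace w with (scal (/ e ^ n) (minus (corrected_energy (lam 3%nat e) (x T) (y T))
            (corrected_energy (lam 3%nat e) (x 0) (y 0))))
          by (unfold scal, minus, plus, opp; simpl; unfold mult; simpl; unfold Rdiv; ring) end.
        apply (is_RInt_scal (V := R_NormedModule)).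
        apply (is_RInt_derive (fun t => corrected_energy (lam 3%nat e) (x t) (y t)));
          intros t; rewrite Rmin_left, Rmax_right by lra; intros Ht.
        + apply (corrected_energy_along (fun j => lam j e) T); assumption.
        + rewrite trajectory_derive in Htr; destruct (Htr t Ht).
          apply along_continuous_rate; eexists; eassumption. }
    apply (is_RInt_unique (V := R_CompleteNormedModule)) in EZ.
    rewrite EZ in Hint; exact Hint.
Qed.

(** The cube of a series of order at least [n / 3]. *)
Lemma cubic_coefficient (lam3 : R -> R) (c3 : nat -> R) (n : nat) :
  expansion c3 lam3 -> (1 <= n)%nat ->
  (forall k, (1 <= k)%nat -> (3 * k < n)%nat -> c3 k = 0) ->
  exists kappa, tends (fun e => lam3 e ^ 3 / e ^ n) kappa /\
    (forall m, n = (3 * m)%nat -> kappa = c3 m ^ 3) /\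
    (~ (exists m, n = (3 * m)%nat) -> kappa = 0).
Proof.
  intros Hexp Hn Hc.
  destruct (Nat.eq_dec (n mod 3) 0) as [Hr | Hr].
  - assert (En : n = (3 * (n / 3))%nat) by (assert (E := Nat.div_mod_eq n 3); lia).
    set (m := (n / 3)%nat) in *; exists (c3 m ^ 3); split; [| split].
    + apply (tends_ext (fun e => (lam3 e / e ^ m) ^ 3)).
      * exists (mkposreal 1 Rlt_0_1); intros e _ He.
        rewrite En; replace (3 * m)%nat with (m + (m + m))%nat by lia.
        rewrite !pow_add; field; apply pow_nonzero, He.
      * apply tends_pow, expansion_lead; [exact Hexp | lia |].
        intros k Hk; apply Hc; lia.
    + intros m' Em'; replace m' with m by lia; reflexivity.
    + intros Hno; exfalso; apply Hno; exists m; exact En.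
  - assert (En : exists m r, (n + r = 3 * S m)%nat /\ (1 <= r <= 2)%nat).
    { exists (n / 3)%nat, (3 - n mod 3)%nat.
      assert (E := Nat.div_mod_eq n 3); assert (B := Nat.mod_upper_bound n 3); lia. }
    (* Here [lam3 = O(eps ^ (m + 1))], and [3 (m + 1) = n + r] exceeds [n]. *)
    destruct En as (m & r & En & Hr'); exists 0; split; [| split].
    + apply (tends_ext (fun e => (lam3 e / e ^ S m) ^ 3 * e ^ r)).
      * exists (mkposreal 1 Rlt_0_1); intros e _ He.
        assert (E : e ^ n * e ^ r = e ^ S m * (e ^ S m * e ^ S m)).
        { rewrite <- !pow_add; f_equal; lia. }
        assert (N1 : e ^ n <> 0) by apply pow_nonzero, He.
        assert (N2 : e ^ S m <> 0) by apply pow_nonzero, He.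
        replace ((lam3 e / e ^ S m) ^ 3 * e ^ r)
          with (lam3 e ^ 3 / e ^ n * (e ^ n * e ^ r / (e ^ S m * (e ^ S m * e ^ S m))))
          by (field; split; assumption).
        rewrite E; field; split; assumption.
      * replace 0 with (c3 (S m) ^ 3 * 0 ^ r) by (destruct r; [lia | simpl; ring]).
        apply tends_mult; apply tends_pow; [| apply tends_id].
        apply expansion_lead; [exact Hexp | lia |].
        intros k Hk; apply Hc; lia.
    + intros m' Em'; exfalso; apply Hr; rewrite Em', Nat.mul_comm; apply Nat.Div0.mod_mul.
    + reflexivity.
Qed.

Lemma unperturbed_return (sx sy : R -> R) (l : nat -> R) (h p T : R) (x y : R -> R) :
  cross_section sx sy -> 0 < h < 1 / 4 ->
  (forall j, (1 <= j <= 6)%nat -> l j = 0) ->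
  return_orbit sx sy l h p T x y -> oval_param h T x y.
Proof.
  intros Hsec Hh Hl (HT & Htr & Ex & Ey & Hp & ExT & EyT & Hfirst).
  assert (Htr0 : trajectory (fun _ => 0) T x y).
  { rewrite trajectory_derive in *; intros t Ht.
    replace (friction (fun _ => 0) (x t) (y t)) with (friction l (x t) (y t));
      [apply Htr, Ht |].
    unfold friction; rewrite !Hl by lia; reflexivity. }
  destruct (Hsec h Hh) as ((EH & Bh) & _).
  assert (HE : forall t, 0 <= t <= T -> H (x t) (y t) = h)
    by (intros t Ht; rewrite (energy_conserved T x y Htr0 t Ht), Ex, Ey; exact EH).
  assert (Eph : p = h).
  { destruct (Hsec p Hp) as ((EHp & _) & _).
    rewrite <- EHp, <- ExT, <- EyT; apply HE; lra. }
  subst p.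
  assert (Htr1 := Htr0); rewrite trajectory_derive_0 in Htr1.
  split; [exact HT |]; split; [exact Htr0 |].
  split; [| split; [congruence |]; split; [congruence |]].
  (* The orbit cannot leave the strip [-1 < x < 1]: on its boundary [H] is at least 1/4. *)
  - intros t Ht; split; [apply HE, Ht |].
    assert (Hx2 : x t ^ 2 < 1); [| split; nra].
    apply Rnot_le_lt; intros Hge.
    destruct (first_exit (fun s => x s ^ 2) t) as (m & Hm & Hm1 & Hm2).
    + lra.
    + intros s Hs; destruct (Htr1 s ltac:(lra)) as [Dx Dy].
      apply (ex_derive_continuous (K := R_AbsRing) (V := R_NormedModule)).
      auto_derive; repeat split; eexists; eassumption.
    + rewrite Ex; nra.
    + exact Hge.
    + specialize (Hm2 m ltac:(lra)); cbv beta in Hm1, Hm2.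
      assert (E1 : x m ^ 2 = 1) by lra.
      assert (E2 := HE m ltac:(lra)); unfold H in E2.
      replace (x m ^ 4) with (x m ^ 2 * x m ^ 2) in E2 by ring.
      rewrite E1 in E2; assert (P := pow2_ge_0 (y m)); lra.
  - intros t Ht [E1 E2]; apply (Hfirst t h Ht Hh); split; congruence.
Qed.

Lemma line_integral_moment (h T : R) (x y : R -> R) (f : R -> R) :
  oval_param h T x y ->
  line_integral_dx (fun u v => f u * v) x y T = RInt (fun t => f (x t) * y t ^ 2) 0 T.
Proof.
  intros Hp; assert (Hd := oval_param_derive h T x y Hp).
  assert (HT : 0 < T) by (destruct Hp; lra).
  apply RInt_ext; intros t Ht; rewrite Rmin_left, Rmax_right in Ht by lra.
  destruct (Hd t ltac:(lra)) as (Hx & _); rewrite (is_derive_unique _ _ _ Hx); to_R; ring.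
Qed.

Theorem theorem4
  (lam : nat -> R -> R) (c : nat -> nat -> R)
  (Hlam : forall j : nat, (1 <= j <= 6)%nat -> expansion (c j) (lam j))
  (sx sy : R -> R) (Hsec : cross_section sx sy)
  (P : R -> R -> R)
  (HP : forall h, 0 < h < 1 / 4 ->
    locally 0 (fun eps : R =>
      first_return sx sy (fun j => lam j eps) h (P h eps)))
  (d : R -> R -> R) (Hd : forall h eps, d h eps = P h eps - h)
  (M : nat -> R -> R)
  (HM : forall h, 0 < h < 1 / 4 -> expansion (fun k => M k h) (d h))
  (n : nat) (Hn : (1 <= n)%nat)
  (Hzero : forall k : nat, (1 <= k < n)%nat ->
    forall h, 0 < h < 1 / 4 -> M k h = 0)
  (Hnonzero : exists h, 0 < h < 1 / 4 /\ M n h <> 0) :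
  forall (h T : R) (x y : R -> R),
    0 < h < 1 / 4 -> oval_param h T x y ->
    let I0 := line_integral_dx (fun _ v => v) x y T in
    let I2 := line_integral_dx (fun u v => u ^ 2 * v) x y T in
    (forall m : nat, n = (3 * m)%nat ->
       M n h = L c n h I0 I2
         - 8 / 1001 * c 3%nat m ^ 3 *
           ((308 * h ^ 2 - 181 * h + 24) * I2 + (80 * h ^ 2 - 12 * h) * I0)) /\
    (~ (exists m : nat, n = (3 * m)%nat) -> M n h = L c n h I0 I2).
Proof.
  (* At [eps = 0] all parameters vanish, so the return map describes closed orbits of [X_0]. *)
  assert (Hoval : forall h, 0 < h < 1 / 4 -> exists T u v,
    oval_param h T u v /\ u 0 = sx h /\ v 0 = sy h).
  { intros h Hh; destruct (locally_singleton _ _ (HP h Hh)) as (T & u & v & Horb).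
    exists T, u, v; split; [| split; apply Horb].
    apply (unperturbed_return sx sy (fun j => lam j 0) h (P h 0) T u v Hsec Hh);
      [| exact Horb].
    intros j Hj; eapply expansion_at_0, Hlam, Hj. }
  assert (Hstep : forall N, (1 <= N <= n)%nat ->
    (forall k j, (1 <= k < N)%nat -> (1 <= j <= 6)%nat -> reduced (fun i => c i k) j = 0) ->
    (forall k, (1 <= k)%nat -> (3 * k < N)%nat -> c 3%nat k = 0) ->
    exists kappa,
      (forall m, N = (3 * m)%nat -> kappa = c 3%nat m ^ 3) /\
      (~ (exists m, N = (3 * m)%nat) -> kappa = 0) /\
      forall h T u v, 0 < h < 1 / 4 -> oval_param h T u v -> u 0 = sx h -> v 0 = sy h ->
        M N h = RInt (fun t => melnikov_integrand kappa (reduced (fun j => c j N))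
                        (u t) (v t)) 0 T).
  { intros N HN Hred Hcub.
    destruct (cubic_coefficient (lam 3%nat) (c 3%nat) N (Hlam 3%nat ltac:(lia))
      (proj1 HN) Hcub) as (kappa & Hk & Hk1 & Hk2).
    exists kappa; split; [exact Hk1 |]; split; [exact Hk2 |].
    intros h T u v Hh Hp Eu Ev.
    apply (melnikov_limit lam c sx sy (P h) (fun k => M k h) N h T kappa u v); auto.
    - assert (E := HM h Hh); unfold expansion in *; revert E; apply filter_imp.
      intros e; rewrite Hd; auto.
    - apply HN.
    - intros k Hk'; apply Hzero; [lia | exact Hh]. }
  assert (Hflat : forall N, (N < n)%nat ->
    (forall k j, (1 <= k <= N)%nat -> (1 <= j <= 6)%nat -> reduced (fun i => c i k) j = 0) /\
    (forall k, (1 <= k)%nat -> (3 * k <= N)%nat -> c 3%nat k = 0)).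
  { induction N as [| N IH]; intros HN; [split; intros; lia |].
    destruct (IH ltac:(lia)) as [IH1 IH2].
    destruct (Hstep (S N) ltac:(lia)) as (kappa & Hk1 & Hk2 & HMN).
    { intros k j Hk Hj; apply IH1; lia. }
    { intros k Hk Hk3; apply IH2; lia. }
    destruct (melnikov_integral_zero kappa (reduced (fun j => c j (S N)))) as [Ek Eg].
    { reflexivity. }
    { intros h Hh; destruct (Hoval h Hh) as (T & u & v & Hp & Eu & Ev).
      exists T, u, v; split; [exact Hp |].
      rewrite <- (HMN h T u v Hh Hp Eu Ev); apply Hzero; [lia | exact Hh]. }
    split.
    - intros k j Hk Hj; destruct (Nat.eq_dec k (S N)) as [-> | Hne];
        [apply Eg, Hj | apply IH1; lia].
    - intros k Hk Hk3; destruct (Nat.eq_dec (3 * k) (S N)) as [E | Hne];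
        [| apply IH2; lia].
      rewrite (Hk1 k (eq_sym E)) in Ek.
      destruct (Req_dec (c 3%nat k) 0) as [Z | Z]; [exact Z |].
      exfalso; apply (pow_nonzero _ 3 Z), Ek. }
  intros h T x y Hh Hp I0 I2.
  destruct (Hflat (pred n) ltac:(lia)) as [F1 F2].
  destruct (Hstep n ltac:(lia)) as (kappa & Hk1 & Hk2 & HMn).
  { intros k j Hk Hj; apply F1; lia. }
  { intros k Hk Hk3; apply F2; lia. }
  destruct (Hoval h Hh) as (T0 & u & v & Hq & Eu & Ev).
  assert (E0 : I0 = RInt (fun t => v t ^ 2) 0 T0).
  { transitivity (RInt (fun t => (x t ^ 2) ^ 0 * y t ^ 2) 0 T).
    - rewrite <- (line_integral_moment h T x y (fun z => (z ^ 2) ^ 0) Hp).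
      apply RInt_ext; intros t _; simpl; to_R; ring.
    - rewrite (oval_integral_unique h T T0 x y u v 0 Hh Hp Hq).
      apply RInt_ext; intros t _; simpl; to_R; ring. }
  assert (E2 : I2 = RInt (fun t => u t ^ 2 * v t ^ 2) 0 T0).
  { transitivity (RInt (fun t => (x t ^ 2) ^ 1 * y t ^ 2) 0 T).
    - rewrite <- (line_integral_moment h T x y (fun z => (z ^ 2) ^ 1) Hp).
      apply RInt_ext; intros t _; simpl; to_R; ring.
    - rewrite (oval_integral_unique h T T0 x y u v 1 Hh Hp Hq).
      apply RInt_ext; intros t _; simpl; to_R; ring. }
  assert (EM := HMn h T0 u v Hh Hq Eu Ev).
  rewrite (melnikov_L_form h T0 u v kappa c n Hq) in EM.
  rewrite <- E0, <- E2 in EM.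
  split.
  - intros m Em; rewrite EM, (Hk1 m Em); reflexivity.
  - intros Hno; rewrite EM, (Hk2 Hno); ring.
Qed.
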